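(* Let $k\ge 3$ be a fixed integer. There is a coloring oracle $A$ for $2$-colorable $k$-uniform hypergraphs satisfying $T_A(n)=O(1)$. Moreover, $A$ uses no memory at all for keeping information between successive calls.
   Context: A $k$-uniform hypergraph ($k$-graph) $\mathcal H$ on vertex set $\{1,\dots,n\}$ has edges that are $k$-element vertex subsets; it is $2$-colorable if there is $c:V(\mathcal H)\to\{0,1\}$ with no monochromatic edge (a legal $2$-coloring). A coloring oracle is a randomized algorithm $A$ whose input is a vertex $u$ of a $2$-colorable $k$-graph $\mathcal H$; $A$ accesses $\mathcal H$ only via edge queries ''is $(v_1,\dots,v_k)$ an edge of $\mathcal H$?'', always returns a color in $\{0,1\}$ for $u$, and satisfies: (i) for every sequence of queries $u_1,u_2,\dots$, the answers of $A$ are consistent with a single legal $2$-coloring of $\mathcal H$; (ii) $A$ uses only $o(n)$ memory for keeping information between different calls. $T_A(\mathcal H,u)$ denotes the expected time $A$ takes to return a color for $u$ in $\mathcal H$, $T_A(\mathcal H)=\max_{u\in V(\mathcal H)}T_A(\mathcal H,u)$, and $T_A(n)$ is the average of $T_A(\mathcal H)$ over all $2$-colorable $k$-graphs $\mathcal H$ on $\{1,\dots,n\}$. Constants in $O(\cdot)$ may depend on $k$. *)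

(* Defs.v *)
From HB Require Import structures.
From mathcomp Require Import all_boot all_order all_algebra.
From mathcomp Require Import all_classical all_reals all_analysis.

Set Implicit Arguments.
Unset Strict Implicit.
Unset Printing Implicit Defensive.

Import Order.TTheory GRing.Theory Num.Theory.
Import numFieldNormedType.Exports.

(** * Hypergraphs: the vertices {1, ..., n} are rendered as 'I_n *)

Definition hypergraph (n : nat) := {set {set 'I_n}}.

Definition k_uniform n (k : nat) (H : hypergraph n) : bool :=
  [forall e in H, #|e| == k].

Definition coloring n := {ffun 'I_n -> bool}.

Definition monochromatic n (c : coloring n) (e : {set 'I_n}) : bool :=
  [exists b, [forall v in e, c v == b]].

Definition legal n (H : hypergraph n) (c : coloring n) : bool :=
  [forall e in H, ~~ monochromatic c e].

Definition two_colorable n (H : hypergraph n) : bool := [exists c, legal H c].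

Definition two_colorable_kgraphs (k n : nat) : {set hypergraph n} :=
  [set H : hypergraph n | k_uniform k H && two_colorable H].

(** * The model of computation

   A randomized random access machine with unit-cost additions, subtractions
   and comparisons on natural numbers (no multiplication), indirect addressing
   and structured control flow.  Its working memory consists of arrays of
   naturals; array names are constants of the program, so a program mentions
   finitely many arrays.  The persistent memory, the only information kept
   from one call to the next, is a sequence of bits.  A program is a fixed
   finite object that does not depend on n: each step below evaluates a number
   of operations bounded in terms of the program (and k) only. *)

Inductive expr : Type :=
| Const of nat
| Get of nat & expr              (* Get i e : cell e of array i *)
| Bit of expr                    (* persistent bit; 0 when out of range *)
| Plus of expr & expr
| Minus of expr & expr           (* truncated *)
| Less of expr & expr
| Equal of expr & expr.

Inductive cmd (k : nat) : Type :=
| Skip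
| Put of nat & expr & expr       (* Put i e f : cell e of array i := f *)
| PutBit of expr & expr          (* no effect when out of range *)
| Flip of nat & expr             (* cell := fair coin *)
| Sample of nat & expr           (* cell := uniformly random vertex *)
| Query of nat & expr & k.-tuple expr    (* cell := answer to an edge query *)
| Seq of cmd k & cmd k
| Cond of expr & cmd k & cmd k
| While of expr & cmd k.

Arguments Skip {k}.
Arguments Put {k}.
Arguments PutBit {k}.
Arguments Flip {k}.
Arguments Sample {k}.

Definition store := nat -> nat -> nat.

Definition upd (st : store) (i a x : nat) : store :=
  fun j b => if (j == i) && (b == a) then x else st j b.

Definition get_bit s (m : s.-tuple bool) (a : nat) : bool := nth false m a.

Definition set_bit s (m : s.-tuple bool) (a : nat) (b : bool) : s.-tuple bool :=
  [tuple if val i == a then b else tnth m i | i < s].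

Fixpoint eval_expr s (st : store) (m : s.-tuple bool) (e : expr) : nat :=
  match e with
  | Const x => x
  | Get i e => st i (eval_expr st m e)
  | Bit e => get_bit m (eval_expr st m e)
  | Plus e f => eval_expr st m e + eval_expr st m f
  | Minus e f => eval_expr st m e - eval_expr st m f
  | Less e f => eval_expr st m e < eval_expr st m f
  | Equal e f => eval_expr st m e == eval_expr st m f
  end.

(* On a k-uniform H and k names vs, the set below has k elements exactly when
   the names are distinct and all denote vertices. *)
Definition edge_query n (H : hypergraph n) (vs : seq nat) : bool :=
  [set v : 'I_n | val v \in vs] \in H.

(* The commands that remain to be executed, the working memory, and the
   persistent memory. *)
Record config (k s : nat) : Type := Config {
  todo : seq (cmd k);
  work : store;
  pmem : s.-tuple bool
}.

(* A fresh independent coin and random vertex are drawn at every step, and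
   ignored unless the command is Flip or Sample. *)
Definition draw (n : nat) : finType := (bool * 'I_n)%type.

Definition step k n s (H : hypergraph n) (c : config k s) (r : draw n) :
    config k s :=
  let: Config K st m := c in
  match K with
  | [::] => c
  | p :: K =>
    match p with
    | Skip => Config K st m
    | Put i e f => Config K (upd st i (eval_expr st m e) (eval_expr st m f)) m
    | PutBit e f =>
        Config K st (set_bit m (eval_expr st m e) (eval_expr st m f != 0))
    | Flip i e => Config K (upd st i (eval_expr st m e) r.1) m
    | Sample i e => Config K (upd st i (eval_expr st m e) (val r.2)) m
    | Query i e vs =>
        Config K (upd st i (eval_expr st m e)
                    (edge_query H [seq eval_expr st m v | v <- vs])) m
    | Seq p1 p2 => Config (p1 :: p2 :: K) st m
    | Cond e p1 p2 =>
        Config ((if eval_expr st m e != 0 then p1 else p2) :: K) st m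
    | While e q =>
        if eval_expr st m e != 0 then Config (q :: While e q :: K) st m
        else Config K st m
    end
  end.

Definition run k n s (H : hypergraph n) (c : config k s) (w : seq (draw n)) :
    config k s :=
  foldl (step H) c w.

Definition halted k s (c : config k s) : bool := nilp (todo c).

Definition returned k s (c : config k s) (a : bool) : Prop :=
  halted c /\ work c 0 0 = a.

(* A call starts with n and the vertex u in cell 0 of arrays 0 and 1. *)
Definition init k n s (p : cmd k) (m : s.-tuple bool) (u : 'I_n) :
    config k s :=
  Config [:: p] (upd (upd (fun _ _ => 0) 0 0 n) 1 0 (val u)) m.

(** * Coloring oracles *)

(* A program together with the number of bits kept between calls. *)
Record algorithm (k : nat) : Type := Algorithm {
  prog : cmd k;
  psize : nat -> nat
}.

Section Calls.
Variables (k n : nat) (A : algorithm k) (H : hypergraph n).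

Definition memory := (psize A n).-tuple bool.

Definition blank : memory := [tuple false | _ < psize A n].

Definition start (m : memory) (u : 'I_n) : config k (psize A n) :=
  init (prog A) m u.

(* For some outcome of its random draws, the call on u with persistent memory
   m returns a and leaves persistent memory m'. *)
Definition call (m : memory) (u : 'I_n) (a : bool) (m' : memory) : Prop :=
  exists w : seq (draw n),
    returned (run H (start m u) w) a /\ pmem (run H (start m u) w) = m'.

Inductive reachable : memory -> Prop :=
| reachable_blank : reachable blank
| reachable_call m u a m' : reachable m -> call m u a m' -> reachable m'.

Definition always_returns : Prop :=
  forall (m : memory) (u : 'I_n) (w : nat -> draw n), reachable m ->
    exists (t : nat) (a : bool), returned (run H (start m u) (mkseq w t)) a.

Definition consistent : Prop :=
  forall (u : nat -> 'I_n) (a : nat -> bool) (m : nat -> memory),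
    m 0 = blank ->
    (forall i, call (m i) (u i) (a i) (m i.+1)) ->
    exists2 c : coloring n, legal H c & forall i, c (u i) = a i.

End Calls.

Definition coloring_oracle (R : realType) k (A : algorithm k) : Prop :=
  [/\ forall n (H : hypergraph n), H \in two_colorable_kgraphs k n ->
        always_returns A H,
      forall n (H : hypergraph n), H \in two_colorable_kgraphs k n ->
        consistent A H
    & ((fun n => (psize A n)%:R : R^o) =o_\oo (fun n => n%:R : R^o))%R%classic].

Definition memoryless k (A : algorithm k) : Prop := forall n, psize A n = 0.

(** * Running time *)

Local Open Scope ring_scope.

Section Time.
Variables (R : realType) (k n : nat) (A : algorithm k) (H : hypergraph n).

Definition halts_at (m : memory n A) (u : 'I_n) (t : nat)
    (w : t.-tuple (draw n)) : bool :=
  halted (run H (start m u) w) &&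
  [forall i : 'I_t, ~~ halted (run H (start m u) (take i w))].

Definition prob_time (m : memory n A) (u : 'I_n) (t : nat) : R :=
  #|[set w : t.-tuple (draw n) | halts_at m u w]|%:R
  / #|{: t.-tuple (draw n)}|%:R.

Definition expected_time (m : memory n A) (u : 'I_n) : \bar R :=
  (\sum_(0 <= t <oo) (t%:R * prob_time m u t)%:E)%E.

(* Worst case over the contents that the persistent memory can have. *)
Definition vertex_time (u : 'I_n) : \bar R :=
  ereal_sup [set expected_time m u | m in reachable (A := A) H]%classic.

Definition graph_time : \bar R :=
  \big[maxe/0%E]_(u < n) vertex_time u.

End Time.

Definition average_time (R : realType) k (A : algorithm k) (n : nat) : \bar R :=
  ((#|two_colorable_kgraphs k n|%:R^-1)%:E *
   \sum_(H in two_colorable_kgraphs k n) graph_time R A H)%E.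

(* Main.v *)
(** A round of the oracle draws 2k - 1 random vertices, a k-set A and a
   (k-1)-set B.  If every k-subset of A and B other than A is an edge, then in
   every legal coloring A is monochromatic and B has the opposite color; one
   more edge through B then ties the color of A to that of vertex 0, and an
   edge joining u to B or to a (k-1)-subset of A determines the color of u
   relative to vertex 0.  Hence all successful rounds agree with every legal
   coloring normalized at vertex 0, in particular with the one returned by the
   exhaustive search that is run after linearly many failed rounds.

   For all but a 2^(- const n^2) fraction of the 2-colorable k-graphs a round
   succeeds with probability bounded below.  By a union bound over colorings c
   it suffices to look at random subgraphs of the k-sets that are not
   monochromatic under c.  If c is unbalanced there are too few of them to
   matter.  If c is balanced, there are, for k >= 3, families of order n^2
   candidate draws whose required edges are pairwise disjoint (lines over
   Z_(g+1), any two of which agree in at most one coordinate), so that a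
   Chernoff bound applies; the translates of such a family cover all draws
   uniformly.  The exceptional k-graphs are rare enough to absorb the
   exponential worst-case time of the oracle. *)

Require Import Defs.
From mathcomp Require Import all_boot all_order all_algebra.
From mathcomp Require Import all_classical all_reals all_analysis.
From mathcomp Require Import fintype finset zify.

Set Implicit Arguments.
Unset Strict Implicit.
Unset Printing Implicit Defensive.

(** * Elementary inequalities for powers *)

Lemma leq_expl (x y e : nat) : x <= y -> x ^ e <= y ^ e.
Proof. by case: e => // e; rewrite leq_exp2r. Qed.

Lemma bernoulli_nat (x j : nat) : (x + j) * x ^ j <= x * x.+1 ^ j.
Proof.
elim: j => [|j IH]; first by rewrite !expn0 addn0 !muln1.
rewrite !expnS; move: IH; move: (x ^ j) (x.+1 ^ j) => a b; nia.
Qed.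

Lemma double_pred_exp (D : nat) : 1 < D -> 2 * D.-1 ^ D <= D ^ D.
Proof.
case: D => [|[|x]] //= _; have := bernoulli_nat x.+1 x.+2.
set a := x.+1 ^ x.+2; set b := x.+2 ^ x.+2; nia.
Qed.

(** Iterates [(1 - 1/D)^D <= 1/2], a case of Bernoulli's inequality, with denominators cleared. It
    serves both the Chernoff bound and the probability that all sampling rounds fail. *)
Lemma double_pred_exp_iter (D j r : nat) :
  1 < D -> D * j <= r -> 2 ^ j * D.-1 ^ r <= D ^ r.
Proof.
move=> D1 /subnKC <-; rewrite !expnD mulnA !expnM -expnMn.
by rewrite leq_mul ?leq_expl ?leq_pred ?double_pred_exp.
Qed.

(** * A Chernoff bound for disjoint edge sets *)

Section TailBound.
Variable T : finType.

(** Independence for a uniform random subset: its traces on [E] and off [E] vary freely, so the sum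
    runs over a product. *)
Lemma sum_powerset_setD (Om E : {set T}) (f g : {set T} -> nat) :
  E \subset Om ->
  (forall H, f H = f (H :&: E)) -> (forall H, g H = g (H :\: E)) ->
  \sum_(H in powerset Om) f H * g H =
  (\sum_(X in powerset E) f X) * \sum_(H in powerset (Om :\: E)) g H.
Proof.
move=> sEO fE gE; rewrite big_distrlr pair_big /=.
rewrite (reindex_onto (fun p : {set T} * {set T} => p.1 :|: p.2)
   (fun H => (H :&: E, H :\: E))) /=; last first.
  by move=> H _; rewrite setID.
apply: eq_big => [[X H]|[X H]] /=.
  rewrite !inE; apply/andP/andP => [[sXO /eqP[e1 e2]]|[sX sH]].
    by split; [rewrite -e1 subsetIr | rewrite -e2 setSD].
  split; first by rewrite subUset (subset_trans sX) // (subset_trans sH) ?subsetDl.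
  move: sH; rewrite subsetD => /andP[_ dHE].
  rewrite setIUl (setIidPl sX) setDUl (setDidPl dHE).
  rewrite (disjoint_setI0 dHE) setU0.
  by move: sX; rewrite -setD_eq0 => /eqP ->; rewrite set0U.
move=> /andP[_ /eqP[e1 e2]]; rewrite fE gE [X in f X]e1 [X in g X]e2 //.
Qed.

(* Weighting H by 2 for each unsatisfied Rq j is the exponential moment
   2 ^ (size s) E[2 ^ - #satisfied], which factorizes over the disjoint Rq j. *)
Lemma sum_weight_le (J : eqType) (Rq : J -> {set T}) (K : nat) (s : seq J) (Om : {set T}) :
  uniq s -> (forall j, j \in s -> #|Rq j| <= K) ->
  (forall j, j \in s -> Rq j \subset Om) ->
  {in s &, forall i j, i != j -> [disjoint Rq i & Rq j]} ->
  (\sum_(H in powerset Om) \prod_(j <- s) (if Rq j \subset H then 1 else 2))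
    * (2 ^ K.+1) ^ size s
  <= 2 ^ #|Om| * (2 * (2 ^ K.+1).-1) ^ size s.
Proof.
elim: s Om => [|j s IH] Om /=.
  move=> _ _ _ _; under eq_bigr do rewrite big_nil.
  by rewrite sum1_card card_powerset.
move=> /andP[js us] cK sO dj.
under eq_bigr do rewrite big_cons.
have jO : Rq j \subset Om by rewrite sO ?mem_head.
rewrite (@sum_powerset_setD Om (Rq j) (fun H => if Rq j \subset H then 1 else 2)
   (fun H => \prod_(j <- s) (if Rq j \subset H then 1 else 2))) //; first last.
- move=> H; apply: eq_big_seq => i si.
  have d : [disjoint Rq i & Rq j].
    by apply: dj; rewrite ?inE ?si ?eqxx ?orbT //; apply: contraNneq js => <-.
  by rewrite subsetD d andbT.
- by move=> H; rewrite subsetI subxx andbT.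
have c1 i : i \in s -> #|Rq i| <= K by move=> si; rewrite cK // inE si orbT.
have c2 i : i \in s -> Rq i \subset Om :\: Rq j.
  move=> si; rewrite subsetD sO ?inE ?si ?orbT //=.
  by apply: dj; rewrite ?inE ?si ?eqxx ?orbT //; apply: contraNneq js => <-.
have c3 : {in s &, forall a b, a != b -> [disjoint Rq a & Rq b]}.
  by move=> a b sa sb; apply: dj; rewrite inE ?sa ?sb orbT.
have {c1 c2 c3 IH} := IH (Om :\: Rq j) us c1 c2 c3; rewrite !expnS.
have -> : \sum_(X in powerset (Rq j)) (if Rq j \subset X then 1 else 2)
       = (2 * 2 ^ #|Rq j|).-1.
  rewrite (bigD1 (Rq j)) ?inE //= subxx.
  rewrite (eq_bigr (fun=> 2)); last first.
    by move=> X; rewrite powersetE eqEsubset => /andP[->] /= /negPf ->.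
  rewrite sum_nat_const.
  have := cardsD1 (Rq j) (powerset (Rq j)); rewrite card_powerset powersetE subxx.
  have -> : #|[pred i | (i \in powerset (Rq j)) & i != Rq j]| = #|powerset (Rq j) :\ Rq j|.
    by apply: eq_card => X; rewrite !inE andbC.
  move=> ->; lia.
have := cardsID (Rq j) Om; rewrite (setIidPr jO) => <-; rewrite expnD.
have : 2 ^ #|Rq j| <= 2 ^ K by rewrite leq_exp2l // cK ?mem_head.
have := expn_gt0 2 #|Rq j|.
move: (2 ^ #|Rq j|) (2 ^ K) (2 ^ #|Om :\: Rq j|) (_ ^ size s) (_ ^ size s) => r d o a b.
move: (bigop _ _ _) => S /= r0 rd h.
(* The event of [j] contributes a factor [2 - 1/r] with [r = 2 ^ #|Rq j|]; replacing [r] by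
   [d = 2 ^ K] only increases it. *)
have h2 : (2 * r).-1 * (2 * d) <= r * (2 * (2 * d).-1) by nia.
by have := leq_mul h2 h; lia.
Qed.

(** Markov's inequality: a set counted here has weight at least [2 ^ (#|J| - M)], while the average
    weight is at most [2 ^ #|J| * (1 - 2 ^ -(K+1)) ^ #|J|], hence at most [2 ^ (#|J| - 2 M)] by the
    size of [J]. *)
Lemma few_good_count (J : finType) (Rq : J -> {set T}) (K M : nat) (Om : {set T}) :
  (forall j, #|Rq j| <= K) -> (forall j, Rq j \subset Om) ->
  (forall i j, i != j -> [disjoint Rq i & Rq j]) ->
  2 ^ K.+1 * (2 * M) <= #|J| ->
  #|[set H in powerset Om | #|[set j | Rq j \subset H]| <= M]| * 2 ^ M <= 2 ^ #|Om|.
Proof.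
move=> cK sO dj hJ; set B := [set H in _ | _].
have := @sum_weight_le J Rq K (enum J) Om (enum_uniq _) (fun j _ => cK j)
  (fun j _ => sO j) (fun i j _ _ => @dj i j).
rewrite -cardE; set D := 2 ^ K.+1; set S := (\sum_(H in _) _) => hS.
have hB : #|B| * 2 ^ (#|J| - M) <= S.
  rewrite -sum_nat_const; apply: (@leq_trans
    (\sum_(H in B) \prod_(j <- enum J) (if Rq j \subset H then 1 else 2))).
    apply: leq_sum => H; rewrite inE => /andP[_ hM].
    rewrite big_enum /= (bigID (fun j => Rq j \subset H)) /=.
    rewrite big1 ?mul1n => [|j ->] //.
    rewrite (eq_bigr (fun=> 2)) => [|j /negPf -> //].
    rewrite prod_nat_const leq_exp2l // leq_subLR.
    rewrite -(cardC [pred j | Rq j \subset H]) leq_add //.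
    by apply: leq_trans hM; rewrite subset_leq_card //; apply/subsetP => j; rewrite !inE.
  rewrite /S big_mkcond [leqRHS]big_mkcond /=; apply: leq_sum => H _.
  by rewrite !inE; case: (H \subset Om) => //=; case: ifP.
have D1 : 1 < D by rewrite /D expnS; have := expn_gt0 2 K; lia.
have hD := double_pred_exp_iter D1 hJ.
have : #|B| * 2 ^ (#|J| - M) * D ^ #|J| * 2 ^ M <= 2 ^ #|Om| * (2 * D.-1) ^ #|J| * 2 ^ M.
  by rewrite leq_mul2r orbC (leq_trans _ hS) // leq_mul2r hB orbT.
have MJ : M <= #|J| by apply: leq_trans hJ; nia.
have eJ : 2 ^ #|J| = 2 ^ (#|J| - M) * 2 ^ M by rewrite -expnD subnK.
rewrite expnMn eJ mulnA.
have p1 : 0 < D.-1 ^ #|J| by rewrite expn_gt0; lia.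
have p2 := expn_gt0 2 (#|J| - M).
have e2 : 2 ^ (2 * M) = 2 ^ M * 2 ^ M by rewrite mul2n -addnn expnD.
rewrite e2 in hD; move: hD p1 p2 (expn_gt0 2 M).
move: (D ^ _) (D.-1 ^ _) (2 ^ (_ - _)) (2 ^ M) (2 ^ #|Om|) #|B| => a b c d o x h p1 p2 p3.
move=> h2.
have h3 := leq_mul (leqnn (x * c * d)) h.
have h4 : (x * d) * (c * d * d * b) <= o * (c * d * d * b) by lia.
by move: h4; rewrite leq_pmul2r //; rewrite !muln_gt0 p1 p2 p3.
Qed.

End TailBound.

(** * Draws that force the color of a vertex *)

Section Gadget.
Variable k : nat.

(** Conditions on a draw are phrased by positions, not vertices: the first [k] positions hold A, the
    others B. The list of required queries then depends on [k] only. *)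
Definition npos := k + k.-1.

Definition sideA : {set 'I_npos} := [set i : 'I_npos | i < k].
Definition sideA' : {set 'I_npos} := [set i : 'I_npos | i < k.-1].
Definition sideB : {set 'I_npos} := [set i : 'I_npos | k <= i].

Definition crossing : {set {set 'I_npos}} :=
  [set S : {set 'I_npos} | (#|S| == k) && (S != sideA)].

Definition names (p : nat -> nat) (S : {set 'I_npos}) : seq nat :=
  [seq p (val i) | i <- enum S].

Definition pass n (H : hypergraph n) (u : nat) (p : nat -> nat) : bool :=
  [&& [forall S in crossing, edge_query H (names p S)],
      edge_query H (0 :: names p sideB)
    & edge_query H (u :: names p sideA') || edge_query H (u :: names p sideB)].

Lemma card_initial (j : nat) : j <= npos -> #|[set i : 'I_npos | i < j]| = j.
Proof.
move=> jm; rewrite -sum1_card.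
under eq_bigl do rewrite inE.
by rewrite (big_ord_narrow jm) sum1_card card_ord.
Qed.

Lemma card_sideA : #|sideA| = k.
Proof. by rewrite card_initial // leq_addr. Qed.

Lemma sideBE : sideB = ~: sideA.
Proof. by apply/setP => i; rewrite !inE -leqNgt. Qed.

Lemma card_sideA' : #|sideA'| = k.-1.
Proof. by rewrite card_initial // leq_addl. Qed.

Lemma card_sideB : #|sideB| = k.-1.
Proof.
by apply: (@addnI k); rewrite sideBE -{1}card_sideA cardsC card_ord.
Qed.

(** By pigeonhole some color class has at least [k] of the [2k - 1] positions, and its only
    [k]-subset can be A. A position of B in that class could replace position 0 in A and give
    another such subset. *)
Lemma crossing_colors (f : 'I_npos -> bool) : 0 < k ->
  (forall S b, S \in crossing -> ~ {in S, forall i, f i = b}) ->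
  exists b, forall i, f i = b (+) (k <= i).
Proof.
move=> k0 hf; pose cl (b : bool) := [set i | f i == b].
have [b hb] : exists b, k <= #|cl b|.
  have : #|cl true| + #|cl false| = npos.
    have -> : cl false = ~: cl true by apply/setP=> i; rewrite !inE; case: (f i).
    by rewrite cardsC card_ord.
  rewrite /npos => h; case: (leqP k #|cl true|) => h1; first by exists true.
  by exists false; move: h h1; move: #|cl true| #|cl false|; lia.
have inb (S : {set 'I_npos}) : #|S| = k -> S \subset cl b -> S = sideA.
  move=> cS sS; apply/eqP; apply/negPn/negP => nS.
  have hS : S \in crossing by rewrite inE cS eqxx nS.
  by apply: (hf S b hS) => i /(subsetP sS); rewrite inE => /eqP.
have sA : sideA \subset cl b.
  have /card_geqP[s [us ss sub]] := hb.
  have <- : [set i in s] = sideA.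
    apply: inb; first by rewrite cardsE (card_uniqP us).
    by apply/subsetP => i; rewrite inE => /sub.
  by apply/subsetP => i; rewrite inE => /sub.
exists b => i; case: leqP => [ki|ik]; last first.
  by rewrite addbF; apply/eqP; have /(subsetP sA) : i \in sideA; rewrite inE.
rewrite addbT; apply/eqP; rewrite -[_ == _]negbK; apply/negP => fi.
have i0 : 0 < npos by apply: leq_ltn_trans (ltn_ord i).
have z0 : Ordinal i0 \in sideA by rewrite inE.
have niA : i \notin sideA :\ Ordinal i0 by rewrite !inE ltnNge ki andbF.
have eA : i |: (sideA :\ Ordinal i0) = sideA.
  apply: inb.
    by rewrite cardsU1 niA; have := cardsD1 (Ordinal i0) sideA; rewrite z0 card_sideA => ->.
  rewrite subUset sub1set inE; apply/andP; split; first by move: fi; clear; case: (f i); case: b.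
  by apply: subset_trans sA; rewrite subsetDl.
have : i \in sideA by rewrite -eA !inE eqxx.
by rewrite inE ltnNge ki.
Qed.

Lemma edge_query_legal n (H : hypergraph n) (c : coloring n) (vs : seq nat) (b : bool) :
  legal H c -> edge_query H vs -> ~ (forall v : 'I_n, val v \in vs -> c v = b).
Proof.
move=> /forall_inP hl /hl /existsP h hv; apply: h; exists b.
by apply/forall_inP => v; rewrite inE => /hv ->.
Qed.

(** Vertex 0 and A are both opposite to B, hence share a color. An edge joining [u] to [sideA']
    makes [u] differ from vertex 0; failing that, the edge through B makes them agree. The
    right-hand side does not mention [c], so all legal colorings give the same answer. *)
Lemma pass_sound n (H : hypergraph n) (c : coloring n) (r u : 'I_n) (p : nat -> nat) :
  1 < k -> (forall i, i < npos -> p i < n) -> val r = 0 -> legal H c ->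
  pass H u p -> c u (+) c r = edge_query H (val u :: names p sideA').
Proof.
move=> k1 pn r0 hl /and3P[/forall_inP hcr hr hu].
pose f (i : 'I_npos) := c (Ordinal (pn i (ltn_ord i))).
have namesP S v : val v \in names p S -> exists2 i, i \in S & f i = c v.
  move=> /mapP[i]; rewrite mem_enum => iS e; exists i => //.
  by congr (c _); apply: val_inj.
have [||b hb] := @crossing_colors f; first lia.
  move=> S b /hcr /(edge_query_legal (b := b) hl) h hS; apply: h => v.
  by move=> /namesP[i /hS <- ->].
have cB v : val v \in names p sideB -> c v = ~~ b.
  by move=> /namesP[i]; rewrite inE => ki <-; rewrite hb ki addbT.
have cA v : val v \in names p sideA' -> c v = b.
  move=> /namesP[i]; rewrite inE => ki <-; rewrite hb leqNgt (leq_trans ki) ?leq_pred //.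
  by rewrite addbF.
have ext (x : 'I_n) S b' : (forall v, val v \in names p S -> c v = b') ->
    edge_query H (val x :: names p S) -> c x = ~~ b'.
  move=> hS /(edge_query_legal (b := b') hl) h; apply/eqP; rewrite -[_ == _]negbK.
  apply/negP => cx; apply: h => v; rewrite inE => /orP[/eqP /val_inj ->|/hS //].
  by move: cx; clear; case: (c x); case: b'.
have cr : c r = b by rewrite (ext _ sideB (~~ b)) ?r0 // negbK.
case: (boolP (edge_query H (val u :: names p sideA'))) hu => [hA _|_ /= hB].
  by rewrite (ext _ _ _ cA hA) cr addNb addbb.
by rewrite (ext _ _ _ cB hB) cr negbK addbb.
Qed.

Lemma crossing_meets (S : {set 'I_npos}) : 0 < k -> S \in crossing ->
  (exists2 i, i \in S & i < k) /\ (exists2 i, i \in S & k <= i).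
Proof.
move=> k0; rewrite inE => /andP[/eqP cS nS]; split.
  have : ~~ (S \subset sideB).
    by apply/negP => /subset_leq_card; rewrite cS card_sideB; lia.
  by case/subsetPn => i iS; rewrite inE -ltnNge => ik; exists i.
have : ~~ (S \subset sideA).
  by apply: contra nS => sS; rewrite eqEcard sS card_sideA cS leqnn.
by case/subsetPn => i iS; rewrite inE -leqNgt => ik; exists i.
Qed.

End Gadget.

Definition nonmono_sets n (k : nat) (c : coloring n) : {set {set 'I_n}} :=
  [set e : {set 'I_n} | (#|e| == k) && ~~ monochromatic c e].

(** * Density of successful draws *)

Section Density.
Variables (n k g : nat) (c : coloring n) (u r : 'I_n).
Variable be : 'I_(npos k) -> 'I_g.+1 -> 'I_n.
Hypothesis k3 : 3 <= k.
Hypothesis be_inj : forall i j x y, be i x = be j y -> i = j /\ x = y.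
Hypothesis be_color : forall i x, c (be i x) = c r (+) (k <= i).
Hypothesis be_fresh : forall i x, be i x \notin [set u; r].

(** A point picks one vertex from each of [2k - 1] disjoint blocks of size [g + 1]. Indexing blocks
    by Z_(g+1) turns points into a group, so that lines and translates make sense. *)
Let point := {ffun 'I_(npos k) -> 'I_g.+1}.

(* Every required edge consists of the vertices drawn at some positions and of
   a subset of {u, r}, where r is the vertex 0. *)
Definition shapes : {set {set 'I_(npos k)} * {set 'I_n}} :=
  [set (S, set0) | S in crossing k] :|:
  [set (sideB k, [set r]);
       (if c u == c r then sideB k else sideA' k, [set u])].

Definition shape_edge (z : point) (s : {set 'I_(npos k)} * {set 'I_n}) : {set 'I_n} :=
  [set be i (z i) | i in s.1] :|: s.2.

Definition required (z : point) : {set {set 'I_n}} :=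
  [set shape_edge z s | s in shapes].

Lemma card_required z : #|required z| <= #|crossing k| + 2.
Proof.
apply: leq_trans (leq_imset_card _ _) _; rewrite /shapes.
apply: leq_trans (leq_card_setU _ _) _; rewrite leq_add ?leq_imset_card //.
by rewrite cards2; case: eqP.
Qed.

(** The bound [1 < #|s.1|] is where [k >= 3] enters: edges through [u] or vertex 0 still contain
    [k - 1 >= 2] drawn vertices. *)
Lemma shapesP s : s \in shapes ->
  [/\ 1 < #|s.1|, #|s.1| + #|s.2| = k & s.2 \subset [set u; r]].
Proof.
rewrite !inE => /or3P[/imsetP[S hS ->]|/eqP->|/eqP->] /=.
- by move: hS; rewrite inE => /andP[/eqP -> _]; rewrite cards0 sub0set addn0; split=> //; lia.
- by rewrite card_sideB cards1 sub1set !inE eqxx orbT; split=> //; lia.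
- by case: ifP => _; rewrite ?card_sideB ?card_sideA' cards1 sub1set !inE eqxx; split=> //; lia.
Qed.

(** Required edges are thus available to subgraphs legal for [c]: crossing sets meet both sides,
    which have opposite colors, and vertex 0 and [u] are each attached to a side of the color
    opposite to their own. *)
Lemma required_nonmono z : required z \subset nonmono_sets k c.
Proof.
apply/subsetP => _ /imsetP[s hs ->]; have [_ cs sur] := shapesP hs.
have inj : injective (fun i => be i (z i)) by move=> i j /be_inj[].
have dis : [disjoint [set be i (z i) | i in s.1] & s.2].
  rewrite disjoint_subset; apply/subsetP => _ /imsetP[i _ ->]; rewrite inE.
  by apply: contra (be_fresh i (z i)); apply: (subsetP sur).
rewrite inE cardsU (disjoint_setI0 dis) cards0 subn0 card_imset // cs eqxx /=.
apply/negP => /existsP[b /forall_inP hb].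
have colS i : i \in s.1 -> c r (+) (k <= i) = b.
  by move=> iS; rewrite -(be_color i (z i)); apply/eqP/hb; rewrite inE imset_f.
have colX x : x \in s.2 -> c x = b by move=> xs; apply/eqP/hb; rewrite inE xs orbT.
have nB : exists i, i \in sideB k.
  by apply/set0Pn; rewrite -card_gt0 card_sideB; lia.
have nA : exists i, i \in sideA' k.
  by apply/set0Pn; rewrite -card_gt0 card_sideA'; lia.
move: hs colS colX; rewrite !inE => /or3P[/imsetP[S hS ->]|/eqP->|/eqP->] /= cS cX.
- have [|[i iS ik] [j jS kj]] := crossing_meets _ hS; first lia.
  by have := cS _ iS; rewrite -(cS _ jS) leqNgt ik kj; case: (c r).
- case: nB => i iB; have := cS _ iB; rewrite -(cX r) ?inE //.
  by move: iB; rewrite inE => ->; case: (c r).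
- have cu := cX u (set11 u); move: cS; case: eqP => [e|e] cS.
    case: nB => i iB; have := cS _ iB; rewrite -cu e.
    by move: iB; rewrite inE => ->; case: (c r).
  case: nA => i iA; have := cS _ iA; rewrite -cu.
  move: iA; rewrite inE => iA; rewrite leqNgt (leq_trans iA) ?leq_pred //.
  by rewrite addbF => /esym /e.
Qed.

(** Blocks are disjoint and avoid [u] and vertex 0, so a common edge determines the coordinates of
    its drawn vertices. There are at least two of them, and [z] and [z'] would agree at both. *)
Lemma required_disjoint (z z' : point) :
  (forall i j, z i = z' i -> z j = z' j -> i = j) -> [disjoint required z & required z'].
Proof.
move=> hz; apply/pred0Pn => -[e /andP[/= /imsetP[s hs ->] /imsetP[s' hs' es]]].
have agree i : i \in s.1 -> z i = z' i.
  move=> iS; have : be i (z i) \in shape_edge z s by rewrite inE imset_f.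
  rewrite es inE => /orP[/imsetP[j _ /be_inj[-> //]]|].
  have [_ _ /subsetP h] := shapesP hs'.
  by move=> /h hu; have := be_fresh i (z i); rewrite hu.
have [/card_gt1P[i [j [iS jS /eqP ij]]] _ _] := shapesP hs.
by apply: ij; apply: hz; apply: agree.
Qed.

Definition ptuple (z : point) : (npos k).-tuple 'I_n := [tuple be i (z i) | i < npos k].

Lemma ptuple_inj : injective ptuple.
Proof.
move=> z z' e; apply/ffunP => i; have := congr1 (fun t => tnth t i) e.
by rewrite !tnth_mktuple => /be_inj[].
Qed.

Definition tuple_fun m (t : m.-tuple 'I_n) (i : nat) : nat := nth 0 (map val t) i.

Lemma tuple_funE m (t : m.-tuple 'I_n) (i : 'I_m) : tuple_fun t i = val (tnth t i).
Proof. by rewrite /tuple_fun -tnth_map (tnth_nth 0). Qed.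

Lemma required_pass (H : hypergraph n) z :
  val r = 0 -> required z \subset H -> pass k H u (tuple_fun (ptuple z)).
Proof.
move=> r0 /subsetP hz.
have e0 S : [set v : 'I_n | val v \in names (tuple_fun (ptuple z)) S]
    = [set be i (z i) | i in S].
  apply/setP => v; rewrite inE; apply/mapP/imsetP => -[i].
    rewrite mem_enum tuple_funE tnth_mktuple => iS /val_inj ->.
    by exists i.
  by move=> iS ->; exists i; rewrite ?mem_enum // tuple_funE tnth_mktuple.
have e1 x S : [set v : 'I_n | val v \in val x :: names (tuple_fun (ptuple z)) S]
    = [set be i (z i) | i in S] :|: [set x].
  by rewrite -e0; apply/setP => v; rewrite !inE orbC.
have hsh s : s \in shapes -> shape_edge z s \in H by move=> hs; apply: hz; rewrite imset_f.
apply/and3P; split.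
- apply/forall_inP => S hS; rewrite /edge_query e0 -[X in X \in H]setU0.
  by apply: (hsh (S, set0)); rewrite inE imset_f.
- by rewrite /edge_query -r0 e1; apply: (hsh (sideB k, [set r])); rewrite !inE eqxx orbT.
- have := hsh (if c u == c r then sideB k else sideA' k, [set u]).
  rewrite !inE eqxx !orbT /edge_query !e1 => /(_ isT).
  by rewrite /shape_edge /=; case: ifP => _ ->; rewrite ?orbT.
Qed.

Variable h : nat.
Hypothesis hg : npos k * h <= g.

Import GRing.Theory.
Local Open Scope ring_scope.

Definition line (q : 'I_g.+1 * 'I_h) : point := [ffun i => q.1 + inord q.2 *+ val i].

(** Agreement at [i < j] equates the two slopes times [j - i] modulo [g + 1]. Both products lie
    below the modulus because [npos k * h <= g], so the slopes coincide, and then the intercepts. *)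
Lemma line_agree (a : point) (q q' : 'I_g.+1 * 'I_h) : q != q' ->
  forall i j, (a + line q) i = (a + line q') i -> (a + line q) j = (a + line q') j -> i = j.
Proof.
move=> qq i j; rewrite !ffunE => /addrI ei /addrI ej.
apply/eqP; apply: contraNT qq.
wlog lt_ij : i j ei ej / (i < j)%N.
  move=> wl ij; case: (ltngtP i j) => [lij|lji|/val_inj e]; first exact: (wl i j).
    by apply: (wl j i) => //; rewrite eq_sym.
  by rewrite e eqxx in ij.
move=> _; case: q q' ei ej => [t s] [t' s'] /= ei ej.
have /(congr1 val) : (inord s : 'I_g.+1) *+ (j - i) = (inord s' : 'I_g.+1) *+ (j - i).
  by move: ej; rewrite -{1 2}(subnKC (ltnW lt_ij)) !mulrnDr !addrA ei => /addrI.
have val_mulrn (x : 'I_g.+1) d : val (x *+ d) = ((x * d) %% g.+1)%N.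
  elim: d => [|d IH]; first by rewrite mulr0n muln0 mod0n.
  by rewrite mulrS /= IH modnDmr mulnS.
rewrite !val_mulrn.
have jm := ltn_ord j; have sh := ltn_ord s; have sh' := ltn_ord s'.
have sm x : (x < h)%N -> (x * (j - i) < g.+1)%N.
  by move=> xh; rewrite ltnS (leq_trans _ hg) // mulnC leq_mul //; lia.
have sg x : (x < h)%N -> (x < g.+1)%N.
  by move=> xh; rewrite ltnS (leq_trans _ hg) //; nia.
rewrite !inordK ?sg // !modn_small ?sm //.
move/eqP; rewrite eqn_pmul2r ?subn_gt0 // => /eqP /val_inj ss.
by move: ei; rewrite ss => /addIr ->.
Qed.

Local Close Scope ring_scope.

(** Double counting: for a fixed line, its translates run through every point exactly once as [a]
    varies. *)
Lemma shift_count (G : pred point) (M : nat) :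
  (forall a, M < #|[set q | G (a + line q)%R]|) ->
  g.+1 ^ npos k * M <= g.+1 * h * #|[set z | G z]|.
Proof.
move=> hG.
have : \sum_(a : point) M <= \sum_(a : point) #|[set q | G (a + line q)%R]|.
  by apply: leq_sum => a _; apply: ltnW.
rewrite sum_nat_const card_ffun !card_ord => /leq_trans; apply.
under eq_bigr do rewrite -sum1dep_card big_mkcond.
rewrite exchange_big /=.
have -> : g.+1 * h = #|{: 'I_g.+1 * 'I_h}| by rewrite card_prod !card_ord.
rewrite -sum_nat_const; apply: leq_sum => q _; rewrite -big_mkcond sum1dep_card.
apply: eq_leq; rewrite -(card_imset _ (addIr (line q))).
apply: eq_card => z; rewrite inE; apply/imsetP/idP.
  by move=> [a]; rewrite inE => hz ->.
by move=> Gz; exists (z - line q)%R; rewrite ?inE subrK.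
Qed.

End Density.

(** * Hypergraphs with few successful draws, for a fixed coloring *)

Definition passing k n (H : hypergraph n) (u : nat) : {set (npos k).-tuple 'I_n} :=
  [set t | pass k H u (tuple_fun t)].

Definition typical (k Q n : nat) (H : hypergraph n) : bool :=
  [forall u : 'I_n, n ^ npos k <= Q * #|passing k H u|].

Lemma exists_blocks n k g (c : coloring n) (u r : 'I_n) :
  (forall b, npos k * g.+1 + 2 <= #|[set v | c v == b]|) ->
  exists be : 'I_(npos k) -> 'I_g.+1 -> 'I_n,
    [/\ forall i j x y, be i x = be j y -> i = j /\ x = y,
        forall i x, c (be i x) = c r (+) (k <= i)
      & forall i x, be i x \notin [set u; r]].
Proof.
move=> hc; pose s b := enum ([set v | c v == b] :\: [set u; r]).
have ss b : npos k * g.+1 <= size (s b).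
  rewrite -cardE; have := hc b; rewrite -(cardsID [set u; r] [set v | c v == b]).
  have : #|[set v | c v == b] :&: [set u; r]| <= 2.
    apply: leq_trans (subset_leq_card (subsetIr _ _)) _.
    by rewrite cards2; case: eqP.
  by move: #|_ :&: _| #|_ :\: _|; lia.
have lt (i : 'I_(npos k)) (x : 'I_g.+1) : i * g.+1 + x < npos k * g.+1.
  by have := ltn_ord i; have := ltn_ord x; nia.
have lts b i x := leq_trans (lt i x) (ss b).
(* Position [i] uses the [i]-th block of length [g + 1] in the list of its color class. Each class
   has room for all the blocks, so the default [u] is never read. *)
pose be (i : 'I_(npos k)) (x : 'I_g.+1) := nth u (s (c r (+) (k <= i))) (i * g.+1 + x).
have bes i x : be i x \in s (c r (+) (k <= i)) by apply: mem_nth.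
have col i x : c (be i x) = c r (+) (k <= i).
  by have := bes i x; rewrite mem_enum !inE => /andP[_ /eqP].
exists be; split=> // [i j x y e|i x].
  have ec : c r (+) (k <= i) = c r (+) (k <= j) by rewrite -(col i x) e col.
  move: e; rewrite /be ec => /eqP; rewrite nth_uniq ?enum_uniq // => /eqP e.
  have ei : i = j.
    apply: val_inj => /=; have := congr1 (divn^~ g.+1) e.
    by rewrite !divnMDl // !divn_small ?addn0.
  by split=> //; apply: val_inj; move: e; rewrite ei => /addnI.
by have := bes i x; rewrite mem_enum 2!inE => /andP[].
Qed.

Lemma leq_card_cover (T I : finType) (B : {set T}) (F : I -> {set T}) :
  (forall x, x \in B -> exists i, x \in F i) -> #|B| <= \sum_i #|F i|.
Proof.
move=> hB; apply: (@leq_trans #|\bigcup_i F i|).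
  by apply/subset_leq_card/subsetP => x /hB[i xi]; apply/bigcupP; exists i.
elim/big_rec2: _ => [|i m A _ IH]; first by rewrite cards0.
by apply: leq_trans (leq_card_setU _ _) _; rewrite leq_add2l.
Qed.

(** By [shift_count], a graph with too few passing draws has a translate with at most [M] lines
    whose required edges are all present. A given translate is that poor for at most a [2 ^ -M]
    fraction of the graphs, and a union bound over the translates follows. *)
Lemma few_passing_count n k h M (c : coloring n) (u r : 'I_n) :
  3 <= k -> val r = 0 ->
  (forall b, npos k * (npos k * h).+1 + 2 <= #|[set v | c v == b]|) ->
  2 ^ (#|crossing k| + 2).+1 * (2 * M) <= (npos k * h).+1 * h ->
  #|[set H in powerset (nonmono_sets k c) |
      (npos k * h).+1 * h * #|passing k H u| < (npos k * h).+1 ^ npos k * M]| * 2 ^ M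
  <= (npos k * h).+1 ^ npos k * 2 ^ #|nonmono_sets k c|.
Proof.
set g := npos k * h => k3 r0 hc hM; have [be [b1 b2 b3]] := exists_blocks u r hc.
pose rq := @required n k g c u r be.
pose few (a : {ffun 'I_(npos k) -> 'I_g.+1}) := [set H in powerset (nonmono_sets k c) |
   #|[set q : 'I_g.+1 * 'I_h | rq (a + line k q)%R \subset H]| <= M].
set B := [set H in _ | _].
have hB : #|B| <= \sum_a #|few a|.
  apply: leq_card_cover => H; rewrite inE => /andP[HO hH].
  apply/existsP; apply: contraLR hH => /existsPn h1; rewrite -leqNgt.
  have h2 a : M < #|[set q : 'I_g.+1 * 'I_h | rq (a + line k q)%R \subset H]|.
    by have := h1 a; rewrite inE HO /= -ltnNge.
  apply: leq_trans (@shift_count k g h (fun z => rq z \subset H) M h2) _.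
  rewrite leq_mul2l; apply/orP; right.
  rewrite -(card_imset _ (ptuple_inj b1)) subset_leq_card //.
  apply/subsetP => t /imsetP[z]; rewrite inE => hz ->.
  by rewrite inE; apply: (required_pass (c := c) (r := r)).
have hfew a : #|few a| * 2 ^ M <= 2 ^ #|nonmono_sets k c|.
  have := @few_good_count _ ('I_g.+1 * 'I_h)%type (fun q => rq (a + line k q)%R)
    (#|crossing k| + 2) M (nonmono_sets k c); apply.
  - by move=> q; apply: card_required.
  - by move=> q; apply: required_nonmono.
  - by move=> q q' qq; apply: required_disjoint => //; apply: line_agree.
  - by rewrite card_prod !card_ord.
rewrite (@leq_trans ((\sum_a #|few a|) * 2 ^ M)) ?leq_mul2r ?hB ?orbT //.
rewrite big_distrl /= (leq_trans (leq_sum _ (fun a _ => hfew a))) //.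
by rewrite sum_nat_const card_ffun !card_ord.
Qed.

(** Each such set contains a vertex of color [b]; one chooses that vertex and then a tuple of
    [k - 1] others. *)
Lemma card_nonmono_le n k w (c : coloring n) (b : bool) : 0 < k ->
  #|[set v | c v == b]| <= w -> #|nonmono_sets k c| <= w * n ^ k.-1.
Proof.
move=> k0 hw; pose X := [set v | c v == b].
pose f (p : 'I_n * (k.-1).-tuple 'I_n) := p.1 |: [set x in p.2].
have hs : nonmono_sets k c \subset f @: setX X setT.
  apply/subsetP => e; rewrite inE => /andP[/eqP ce /existsPn /(_ (~~ b))].
  case/forall_inPn => v ve cv.
  have se : size (enum (e :\ v)) == k.-1.
    by rewrite -cardE; have := cardsD1 v e; rewrite ve ce => ->.
  apply/imsetP; exists (v, Tuple se).
    by rewrite !inE andbT; move: cv; clear; case: (c v); case: b.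
  rewrite /f /= -[LHS](setD1K ve); congr (_ |: _).
  by apply/setP => x; rewrite [RHS]inE mem_enum.
apply: leq_trans (subset_leq_card hs) _; apply: leq_trans (leq_imset_card _ _) _.
by rewrite cardsX cardsT card_tuple card_ord leq_mul2r hw orbT.
Qed.

(** Among [k] disjoint blocks of [n %/ k] vertices, only the first gets color [true]; every
    transversal of the blocks then sees both colors. *)
Lemma exists_nonmono_ge n k : 1 < k ->
  exists c : coloring n, (n %/ k) ^ k <= #|nonmono_sets k c|.
Proof.
move=> k1; set q := n %/ k.
have lt (i : 'I_k) (x : 'I_q) : i * q + x < n.
  have : q * k <= n by apply: leq_divM.
  by have := ltn_ord i; have := ltn_ord x; nia.
pose v i x := Ordinal (lt i x).
have vinj i j x y : v i x = v j y -> i = j /\ x = y.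
  move=> /(congr1 val) /= e.
  have q0 : 0 < q by apply: leq_ltn_trans (ltn_ord x).
  have ei : i = j.
    apply: val_inj => /=; have := congr1 (divn^~ q) e.
    by rewrite !divnMDl // !divn_small ?addn0.
  by split=> //; apply: val_inj; move: e; rewrite ei => /addnI.
pose c : coloring n := [ffun x : 'I_n => x < q]; exists c.
pose f (z : {ffun 'I_k -> 'I_q}) := [set v i (z i) | i in 'I_k].
have fin (z : {ffun 'I_k -> 'I_q}) i : v i (z i) \in f z by apply/imsetP; exists i.
have finj : injective f.
  move=> z z' e; apply/ffunP => i.
  have := fin z i; rewrite e; by move=> /imsetP[j _ /vinj[-> ->]].
rewrite -[q in leqLHS]card_ord -[k in leqLHS]card_ord -card_ffun -cardsT -(card_imset _ finj).
apply/subset_leq_card/subsetP => _ /imsetP[z _ ->]; rewrite inE.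
rewrite card_imset ?card_ord ?eqxx /=; last by move=> i j /vinj[].
apply/existsP => -[b /forall_inP hb].
pose i0 := Ordinal (ltnW k1); pose i1 := Ordinal k1.
have := hb _ (fin z i0); have := hb _ (fin z i1).
rewrite !ffunE /= mul0n add0n mul1n ltn_ord ltnNge leq_addr.
by move=> /eqP <-.
Qed.

Lemma nonmono_legal n k (H : hypergraph n) (c : coloring n) :
  (H \subset nonmono_sets k c) = k_uniform k H && legal H c.
Proof.
apply/subsetP/andP => [h|[/forall_inP h1 /forall_inP h2] e eH].
  by split; apply/forall_inP => e /h; rewrite inE => /andP[].
by rewrite inE h1 // h2.
Qed.

Lemma exp_nonmono_le n k (c : coloring n) :
  2 ^ #|nonmono_sets k c| <= #|two_colorable_kgraphs k n|.
Proof.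
rewrite -card_powerset; apply/subset_leq_card/subsetP => H.
rewrite !inE nonmono_legal => /andP[-> hl] /=.
by apply/existsP; exists c.
Qed.

(** * Rarity of atypical hypergraphs *)

Section Atypical.
Variable k : nat.
Hypothesis k3 : 3 <= k.

Let m := npos k.
Let D := 2 ^ (#|crossing k| + 2).+1.
(** A color class of at most [n / L] vertices leaves so few admissible edges that [(n %/ k) ^ k]
    exceeds them at least twofold. [G] is chosen so that, for large [n], the [2k - 1] blocks and two
    further vertices fit into [n / L]. *)
Let L := 2 * (2 * k) ^ k.
Let G := 2 * L * m ^ 2.

Definition density_const := 4 * D * G ^ m.

Definition atypical n : {set hypergraph n} :=
  [set H in two_colorable_kgraphs k n | ~~ typical k density_const H].

(** The number of slopes, the block length [g + 1], and the Chernoff exponent, which is of order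
    [n^2]. *)
Let height n := n %/ G.
Let side n := (m * height n).+1.
Let tail n := side n * height n %/ (2 * D).

Lemma npos_gt0 : 0 < m. Proof. by rewrite /m /npos; lia. Qed.
Lemma D_gt0 : 0 < D. Proof. by rewrite expn_gt0. Qed.
Lemma L_gt0 : 0 < L. Proof. by rewrite muln_gt0 expn_gt0; lia. Qed.
Lemma G_gt0 : 0 < G. Proof. by rewrite /G 2!muln_gt0 L_gt0 expn_gt0 npos_gt0. Qed.

Lemma height_lt n : n < G * (height n).+1.
Proof. by rewrite mulnC; apply: ltn_ceil G_gt0. Qed.

Lemma height_le n : G * height n <= n.
Proof. by rewrite mulnC leq_divM. Qed.

Lemma side_le n : side n <= n.+1.
Proof.
rewrite ltnS; apply: leq_trans (height_le n); rewrite leq_mul2r; apply/orP; right.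
by rewrite /G; have := L_gt0; have := npos_gt0; nia.
Qed.

Lemma unbalanced_small n : 2 * L * (m + 2) <= n ->
  (m * side n + 2) * n ^ k.-1 + tail n <= (n %/ k) ^ k.
Proof.
move=> hn; set w := m * side n + 2.
have hw : L * w <= n.
  have := height_le n; rewrite /w /side /G.
  have -> : m * (m * height n).+1 + 2 = m ^ 2 * height n + (m + 2) by lia.
  lia.
have ht : tail n <= w * n ^ k.-1.
  apply: leq_trans (leq_div _ _) _; rewrite leq_mul //.
    by rewrite /w; have := npos_gt0; nia.
  apply: leq_trans (leq_div _ _) _.
  by case: k k3 => [|[|[|j]]] // _; rewrite /= expnS leq_pmulr // expn_gt0; lia.
apply: leq_trans (_ : 2 * (w * n ^ k.-1) <= _); first by lia.
have hq : n <= 2 * k * (n %/ k).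
  have : n < (n %/ k).+1 * k by apply: ltn_ceil; lia.
  have : 0 < n %/ k.
    by rewrite divn_gt0; [apply: leq_trans hn; have := L_gt0; rewrite /m /npos; nia|lia].
  nia.
have h2k : 0 < (2 * k) ^ k by rewrite expn_gt0; lia.
rewrite -(leq_pmul2l h2k) -expnMn (leq_trans _ (leq_expl k hq)) //.
have -> : n ^ k = n * n ^ k.-1 by rewrite -expnS prednK //; lia.
have := leq_mul hw (leqnn (n ^ k.-1)); rewrite /L; lia.
Qed.

(** The family has at most [4 * D * tail n] lines, so at least [side n ^ m / (4 D)] draws pass;
    since [n <= G * side n], passing to all draws costs a further factor [G ^ m]. *)
Lemma passing_typical n (H : hypergraph n) : 0 < tail n ->
  (forall u : 'I_n, side n ^ m * tail n <= side n * height n * #|passing k H u|) ->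
  typical k density_const H.
Proof.
move=> t0 hp; apply/forallP => u; have := hp u.
have hJ : side n * height n <= 4 * D * tail n.
  have : side n * height n < (tail n).+1 * (2 * D).
    by apply: ltn_ceil; have := D_gt0; lia.
  have := D_gt0; nia.
move: #|passing k H u| => P h1.
have h2 : side n ^ m <= 4 * D * P.
  rewrite -(leq_pmul2r t0) (leq_trans h1) //.
  by apply: leq_trans (leq_mul hJ (leqnn P)) _; lia.
have h3 : n <= G * side n.
  have := height_lt n; rewrite /side; have := npos_gt0; have := G_gt0; nia.
apply: leq_trans (leq_expl _ h3) _; rewrite expnMn /density_const.
have := leq_mul (leqnn (G ^ m)) h2.
by move: (side n ^ m) (G ^ m) => b a; rewrite (mulnC (4 * D) a) -!mulnA.
Qed.

(** If both color classes are large, the union bound costs [n] for the vertex and [side n ^ m] for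
    the translates, at most [2 ^ (m.+1 * n)] together. If one is small, all subgraphs admissible for
    [c] are outnumbered by a factor [2 ^ tail n] by those of the coloring of [exists_nonmono_ge]. *)
Lemma atypical_coloring n (c : coloring n) : 0 < n -> 0 < tail n ->
  2 * L * (m + 2) <= n ->
  #|[set H in powerset (nonmono_sets k c) | ~~ typical k density_const H]| * 2 ^ tail n
  <= 2 ^ (m.+1 * n) * #|two_colorable_kgraphs k n|.
Proof.
move=> n0 t0 hn; set B := [set H in _ | _].
have B1 : #|B| <= 2 ^ #|nonmono_sets k c|.
  rewrite -card_powerset subset_leq_card //.
  by apply/subsetP => H; rewrite inE => /andP[].
pose w := m * side n + 2.
case: (boolP [forall b, w <= #|[set v | c v == b]|]) => [/forallP hc|].
  pose F (u : 'I_n) := [set H in powerset (nonmono_sets k c) |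
      side n * height n * #|passing k H u| < side n ^ m * tail n].
  have hB : #|B| <= \sum_u #|F u|.
    apply: leq_card_cover => H; rewrite inE => /andP[HO hH].
    apply/existsP; apply: contraR hH => /existsPn h1.
    apply: passing_typical t0 _ => u; have := h1 u.
    by rewrite inE HO /= -leqNgt.
  have hF u : #|F u| * 2 ^ tail n <= side n ^ m * #|two_colorable_kgraphs k n|.
    apply: leq_trans (leq_mul (leqnn _) (exp_nonmono_le k c)).
    apply: (@few_passing_count n k (height n) (tail n) c u (Ordinal n0)) => //.
    rewrite -/D mulnA [D * 2]mulnC mulnC; apply: leq_divM.
  apply: leq_trans (leq_mul hB (leqnn _)) _; rewrite big_distrl /=.
  apply: leq_trans (leq_sum _ (fun u _ => hF u)) _.
  rewrite sum_nat_const card_ord mulnA leq_mul2r; apply/orP; right.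
  have h1 : n <= 2 ^ n by rewrite ltnW // ltn_expl.
  have h2 : side n <= 2 ^ n by apply: leq_trans (side_le n) _; rewrite ltn_expl.
  by rewrite mulSn expnD leq_mul // mulnC expnM leq_expl.
case/forallPn => b; rewrite -ltnNge => /ltnW hb.
have k0 : 0 < k by lia.
have h1 := card_nonmono_le k0 hb.
have [|c' h2] := @exists_nonmono_ge n k; first lia.
have h3 := unbalanced_small hn; rewrite -/w in h3.
apply: leq_trans (_ : #|two_colorable_kgraphs k n| <= _); last by rewrite leq_pmull ?expn_gt0.
apply: leq_trans (exp_nonmono_le k c').
apply: leq_trans (leq_mul B1 (leqnn _)) _.
rewrite -expnD leq_exp2l //; apply: leq_trans h2; apply: leq_trans h3.
by rewrite leq_add2r.
Qed.

Lemma atypical_tail n : 0 < n -> 0 < tail n -> 2 * L * (m + 2) <= n ->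
  #|atypical n| * 2 ^ tail n <= 2 ^ (m.+2 * n) * #|two_colorable_kgraphs k n|.
Proof.
move=> n0 t0 hn.
(* Union bound over the [2 ^ n] colorings, the source of the extra [n] in the exponent. *)
have hA : #|atypical n| <= \sum_(c : coloring n)
    #|[set H in powerset (nonmono_sets k c) | ~~ typical k density_const H]|.
  apply: leq_card_cover => H; rewrite !inE => /andP[/andP[hk /existsP[c hc]] hH].
  by exists c; rewrite !inE nonmono_legal hk hc.
apply: leq_trans (leq_mul hA (leqnn _)) _; rewrite big_distrl /=.
apply: leq_trans (leq_sum _ (fun c _ => atypical_coloring c n0 t0 hn)) _.
by rewrite sum_nat_const card_ffun card_bool card_ord mulnA -expnD -mulSn.
Qed.

Lemma tail_ge F : exists N, forall n, N <= n -> F * n <= tail n.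
Proof.
pose X := 4 * D * F * G + 1; exists (X * G) => n hn.
have hX : X <= height n by rewrite leq_divRL ?G_gt0.
rewrite leq_divRL; last by rewrite muln_gt0 D_gt0.
have h1 : n <= 2 * G * height n.
  by have := height_lt n; have := G_gt0; rewrite /X in hX; nia.
have h2 : 4 * D * F * G * height n <= side n * height n.
  rewrite leq_mul2r; apply/orP; right; apply: leq_trans (_ : height n <= _); first lia.
  by rewrite /side; have := npos_gt0; nia.
apply: leq_trans h2; have := leq_mul (leqnn (F * (2 * D))) h1; lia.
Qed.

Lemma atypical_rare E : exists C, forall n,
  #|atypical n| * 2 ^ (E * n) <= C * #|two_colorable_kgraphs k n|.
Proof.
have [N hN] := tail_ge (m.+2 + E).+1.
(* From [N'] on the superlinear [tail n] wins; below it the trivial bound suffices with constant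
   [2 ^ (E * N')]. The successor forces [0 < n] in the first case. *)
pose N' := (maxn N (2 * L * (m + 2))).+1; exists (2 ^ (E * N')) => n.
have sub : #|atypical n| <= #|two_colorable_kgraphs k n|.
  by apply/subset_leq_card/subsetP => H; rewrite inE => /andP[].
case: (leqP N' n) => hn; last first.
  by rewrite mulnC leq_mul // leq_exp2l // leq_mul2l ltnW ?orbT.
have n0 : 0 < n by apply: leq_trans hn.
have hn1 : N <= n by apply: leq_trans (leq_maxl _ _) (ltnW hn).
have hn2 : 2 * L * (m + 2) <= n by apply: leq_trans (leq_maxr _ _) (ltnW hn).
have ht := hN n hn1.
have t0 : 0 < tail n by apply: leq_trans ht; rewrite muln_gt0.
have h1 := atypical_tail n0 t0 hn2.
apply: leq_trans (_ : #|two_colorable_kgraphs k n| <= _); last by rewrite leq_pmull ?expn_gt0.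
rewrite -(@leq_pmul2l (2 ^ (m.+2 * n))) ?expn_gt0 //.
apply: leq_trans h1; rewrite mulnCA -expnD leq_mul2l leq_exp2l // -mulnDl.
by apply/orP; right; apply: leq_trans ht; rewrite leq_mul2r leqnSn orbT.
Qed.

End Atypical.

(** * Execution and expected running time of programs *)

Section Execution.
Variables (k n s : nat) (H : hypergraph n) (m : s.-tuple bool).
Implicit Types (p q : cmd k) (st : store) (e f : expr) (P Q : store -> Prop).

Lemma run_cat (c : config k s) (v w : seq (draw n)) :
  run H c (v ++ w) = run H (run H c v) w.
Proof. exact: foldl_cat. Qed.

Lemma run_add (t1 t2 : nat) (c1 c2 c3 : config k s) (w : seq (draw n)) :
  (forall v, size v = t1 -> run H c1 v = c2) -> (forall v, size v = t2 -> run H c2 v = c3) ->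
  size w = t1 + t2 -> run H c1 w = c3.
Proof.
move=> h1 h2 sw; rewrite -(cat_take_drop t1 w) run_cat h1 ?h2 //.
  by rewrite size_drop sw addKn.
by rewrite size_takel // sw leq_addr.
Qed.

(** A timed Hoare triple for code that makes no draws: step count and final store are fixed before
    [w], and any continuation [K] may follow. *)
Definition exec p st (T : nat) Q : Prop :=
  exists t st', [/\ t <= T, Q st' &
    forall K w, size w = t -> run H (Config (p :: K) st m) w = Config K st' m].

Lemma exec_conseq p st T T' Q Q' :
  exec p st T Q -> T <= T' -> (forall st', Q st' -> Q' st') -> exec p st T' Q'.
Proof.
move=> [t [st' [tT Qst' h]]] TT' QQ'; exists t, st'; split=> //.
  exact: leq_trans TT'.
exact: QQ'.
Qed.

Lemma exec_put i e f st Q :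
  Q (upd st i (eval_expr st m e) (eval_expr st m f)) -> exec (Put i e f) st 1 Q.
Proof. by move=> hQ; exists 1; eexists; split; [|exact: hQ|move=> K [|r []]]. Qed.

Lemma exec_skip st Q : Q st -> exec Skip st 1 Q.
Proof. by move=> hQ; exists 1; eexists; split; [|exact: hQ|move=> K [|r []]]. Qed.

Lemma exec_query i e vs st Q :
  Q (upd st i (eval_expr st m e) (edge_query H [seq eval_expr st m v | v <- val vs])) ->
  exec (Query i e vs) st 1 Q.
Proof. by move=> hQ; exists 1; eexists; split; [|exact: hQ|move=> K [|r []]]. Qed.

Lemma exec_seq p q st T1 T2 Q1 Q2 :
  exec p st T1 Q1 -> (forall st', Q1 st' -> exec q st' T2 Q2) ->
  exec (Seq p q) st (T1 + T2).+1 Q2.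
Proof.
move=> [t1 [st1 [h1 hQ1 r1]]] /(_ _ hQ1) [t2 [st2 [h2 hQ2 r2]]].
exists (t1 + t2).+1, st2; split=> // [|K [//|r w] /= [sw]].
  by rewrite ltnS leq_add.
by apply: (run_add (r1 _) (r2 K) sw).
Qed.

(** The index of [I] counts the iterations still to come; each costs one guard evaluation besides
    the body, and the failing guard costs the last step. *)
Lemma exec_while e q T (I : nat -> store -> Prop) j st :
  (forall i st, I i.+1 st -> eval_expr st m e != 0 /\ exec q st T (I i)) ->
  (forall st, I 0 st -> eval_expr st m e = 0) ->
  I j st -> exec (While e q) st (j * T.+1).+1 (I 0).
Proof.
move=> hS h0; elim: j st => [|j IH] st hI.
  exists 1, st; split=> // K [//|r []] //= _.
  by rewrite h0.
have [he [t1 [st1 [h1 hI1 r1]]]] := hS _ _ hI.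
have [t2 [st2 [h2 hI2 r2]]] := IH _ hI1.
exists (t1 + t2).+1, st2; split=> // [|K [//|r w] /= [sw]].
  by rewrite mulSn; lia.
by rewrite he; apply: (run_add (r1 _) (r2 K) sw).
Qed.

Definition seqs (l : seq (cmd k)) : cmd k := foldr (@Seq k) Skip l.

(** For code with draws: they may affect the course of the run, but not the answer [b]. *)
Definition returns_within (T : nat) (c : config k s) (b : bool) : Prop :=
  forall w : seq (draw n), T <= size w -> returned (run H c w) b.

Lemma run_halted (c : config k s) w : halted c -> run H c w = c.
Proof. by case: c => [[|//] st m'] _; elim: w. Qed.

Lemma returns_halted T st (b : bool) : st 0 0 = b -> returns_within T (Config [::] st m) b.
Proof. by move=> h w _; rewrite run_halted. Qed.

Lemma returns_run t T c b :
  (forall w, size w = t -> returns_within T (run H c w) b) -> returns_within (t + T) c b.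
Proof.
move=> h w hw; rewrite -(cat_take_drop t w) run_cat; apply: h.
  by rewrite size_takel //; lia.
by rewrite size_drop; lia.
Qed.

Lemma returns_mono T T' c b : T <= T' -> returns_within T c b -> returns_within T' c b.
Proof. by move=> TT h w hw; apply: h; apply: leq_trans hw. Qed.

Lemma returns_exec p st T Q K T' b : exec p st T Q ->
  (forall st', Q st' -> returns_within T' (Config K st' m) b) ->
  returns_within (T + T') (Config (p :: K) st m) b.
Proof.
move=> [t [st' [tT hQ h]]] hK; apply: (@returns_mono (t + T')); first lia.
by apply: returns_run => w sw; rewrite h //; apply: hK.
Qed.

Lemma returns_seq p q K st T b :
  returns_within T (Config (p :: q :: K) st m) b ->
  returns_within T.+1 (Config (Seq p q :: K) st m) b.
Proof. by move=> h; rewrite -add1n; apply: returns_run => -[|r []]. Qed.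

Lemma returns_step T c b : (forall r, returns_within T (step H c r) b) ->
  returns_within T.+1 c b.
Proof. by move=> h; rewrite -add1n; apply: returns_run => -[|r []] // _; apply: h. Qed.

Lemma returns_while e q K st T b :
  returns_within T (if eval_expr st m e != 0 then Config (q :: While e q :: K) st m
                    else Config K st m) b ->
  returns_within T.+1 (Config (While e q :: K) st m) b.
Proof. by move=> h; apply: returns_step => r /=; case: ifP h. Qed.

End Execution.

(** * Truncated mean running times *)

Section ExpectedTime.
Import Order.TTheory GRing.Theory Num.Theory.
Variables (R : realType) (k n s : nat) (H : hypergraph n) (m : s.-tuple bool).
Hypothesis n_gt0 : (0 < n)%N.
Implicit Types (c : config k s) (st : store).
Local Open Scope ring_scope.

Definition avg (T : finType) (F : T -> R) : R := (\sum_x F x) / #|T|%:R.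

Lemma avg_le (T : finType) (F : T -> R) (B : R) :
  0 <= B -> (forall x, F x <= B) -> avg F <= B.
Proof.
move=> B0 hF; rewrite /avg; have [T0|T0] := posnP #|T|.
  by rewrite T0 invr0 mulr0.
rewrite ler_pdivrMr ?ltr0n // (le_trans (ler_sum _ (fun x _ => hF x))) //.
by rewrite sumr_const mulr_natr.
Qed.

Lemma ler_avg (T : finType) (F G : T -> R) :
  (forall x, F x <= G x) -> avg F <= avg G.
Proof. by move=> hF; rewrite /avg ler_wpM2r ?invr_ge0 ?ler0n // ler_sum. Qed.

Lemma avg_ge0 (T : finType) (F : T -> R) : (forall x, 0 <= F x) -> 0 <= avg F.
Proof. by move=> hF; rewrite /avg divr_ge0 ?ler0n // sumr_ge0. Qed.

Lemma avgD (T : finType) (F G : T -> R) : avg (fun x => F x + G x) = avg F + avg G.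
Proof. by rewrite /avg big_split mulrDl. Qed.

Lemma avg_const (T : finType) (a : R) : (0 < #|T|)%N -> avg (fun _ : T => a) = a.
Proof.
by move=> T0; rewrite /avg sumr_const -[a *+ _]mulr_natr mulfK // pnatr_eq0 -lt0n.
Qed.

Lemma card_draw_gt0 : (0 < #|draw n|)%N.
Proof. by rewrite card_prod card_bool card_ord muln_gt0. Qed.

(* Expected number of steps among the first N. *)
Fixpoint mean_time (N : nat) c : R :=
  if N is N'.+1 then
    if halted c then 0 else 1 + avg (fun r : draw n => mean_time N' (step H c r))
  else 0.

Lemma mean_time_ge0 N c : 0 <= mean_time N c.
Proof.
elim: N c => //= N IH c; case: ifP => // _.
by rewrite addr_ge0 ?ler01 // avg_ge0.
Qed.

(** Monotonicity in the horizon lets later bounds take a step without lowering [N]. *)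
Lemma mean_timeS N c : mean_time N c <= mean_time N.+1 c.
Proof.
elim: N c => [|N IH] c; first exact: mean_time_ge0.
rewrite [leRHS]/= [leLHS]/=; case: ifP => // _; rewrite lerD2l; apply: ler_avg => r.
exact: IH.
Qed.

Lemma mean_time_run N c t (B : R) : 0 <= B ->
  (forall w, size w = t -> mean_time N (run H c w) <= B) -> mean_time N c <= t%:R + B.
Proof.
move=> B0; elim: t N c => [|t IH] N c h; first by rewrite add0r; apply: (h [::]).
case: N h => [|N] h /=; first by rewrite addr_ge0.
case: ifP => _; first by rewrite addr_ge0.
rewrite -natr1 [t%:R + 1]addrC -addrA lerD2l; apply: avg_le => [|r].
  by rewrite addr_ge0.
apply: IH => w sw; apply: le_trans (mean_timeS _ _) _.
by apply: (h (r :: w)); rewrite /= sw.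
Qed.

Lemma mean_time_exec N p st T Q K (B : R) : exec (k := k) H m p st T Q -> 0 <= B ->
  (forall st', Q st' -> mean_time N (Config K st' m) <= B) ->
  mean_time N (Config (p :: K) st m) <= T%:R + B.
Proof.
move=> [t [st' [tT hQ h]]] B0 hK.
apply: (@le_trans _ _ (t%:R + B)); last by rewrite lerD2r ler_nat.
by apply: mean_time_run => // w sw; rewrite h //; apply: hK.
Qed.

Lemma mean_time_step N c (B : draw n -> R) : (forall r, 0 <= B r) ->
  (forall r, mean_time N (step H c r) <= B r) -> mean_time N c <= 1 + avg B.
Proof.
move=> B0 h; case: N h => [|N] h /=; first by rewrite addr_ge0 ?ler01 ?avg_ge0.
case: ifP => _; first by rewrite addr_ge0 ?ler01 ?avg_ge0.
rewrite lerD2l; apply: ler_avg => r; apply: le_trans (mean_timeS _ _) _; exact: h.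
Qed.

Lemma mean_time_step1 N c (B : R) : 0 <= B ->
  (forall r, mean_time N (step H c r) <= B) -> mean_time N c <= 1 + B.
Proof.
move=> B0 h; rewrite -(avg_const B card_draw_gt0).
exact: mean_time_step.
Qed.

Lemma avg_draw (F : 'I_n -> R) : avg (fun r : draw n => F r.2) = avg F.
Proof.
rewrite /avg -(pair_bigA _ (fun (b : bool) (v : 'I_n) => F v)) /=.
rewrite sumr_const card_bool card_prod card_bool natrM invfM mulrA.
by rewrite -(mulr_natr (\sum_v F v)) mulfK // pnatr_eq0.
Qed.

Lemma mean_time_sample N i e K st (B : 'I_n -> R) : (forall v, 0 <= B v) ->
  (forall v : 'I_n, mean_time N (Config K (upd st i (eval_expr st m e) v) m) <= B v) ->
  mean_time N (Config (Sample i e :: K) st m) <= 1 + avg B.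
Proof.
by move=> B0 h; rewrite -avg_draw; apply: mean_time_step => [r|[b v]]; [exact: B0|exact: h].
Qed.

Lemma mean_time_returns N T c b : returns_within H T c b -> mean_time N c <= T%:R.
Proof.
elim: N T c => [|N IH] T c h /=; first by rewrite ler0n.
case: ifP => hc; first by rewrite ler0n.
case: T h => [|T] h; first by have [] := h [::] isT; rewrite /= hc.
rewrite -natr1 addrC lerD2r; apply: avg_le => [|r]; first by rewrite ler0n.
by apply: IH => w hw; apply: (h (r :: w)).
Qed.

Lemma sum_tupleS (V : nmodType) (T : finType) t (F : seq T -> V) :
  \sum_(w : t.+1.-tuple T) F w = \sum_x \sum_(w : t.-tuple T) F (x :: w).
Proof.
rewrite pair_big /= (reindex (fun p : T * t.-tuple T => [tuple of p.1 :: p.2])) //=.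
exists (fun w => (thead w, [tuple of behead w])) => [[x w] _|w _] /=.
  by congr (_, _); apply: val_inj.
by rewrite -tuple_eta.
Qed.

Lemma avg_tupleS (T : finType) t (F : seq T -> R) :
  avg (fun w : t.+1.-tuple T => F w) = avg (fun x => avg (fun w : t.-tuple T => F (x :: w))).
Proof.
rewrite /avg sum_tupleS -mulr_suml -mulrA; congr (_ * _).
by rewrite !card_tuple expnS natrM invfM mulrC.
Qed.

(** The event [halts_at] for plain sequences and arbitrary configurations, so that one can condition
    on the first draw. *)
Definition stops_at c (w : seq (draw n)) : bool :=
  halted (run H c w) && all (fun i => ~~ halted (run H c (take i w))) (iota 0 (size w)).

Definition stop_prob t c : R := avg (fun w : t.-tuple (draw n) => (stops_at c w)%:R).

Lemma stop_prob0 c : stop_prob 0 c = (halted c)%:R.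
Proof.
rewrite /stop_prob /avg card_tuple expn0 invr1 mulr1.
rewrite (bigD1 [tuple]) //= big1 ?addr0 => [|w]; last by rewrite [w]tuple0 => /eqP.
by rewrite /stops_at /= andbT.
Qed.

Lemma stop_probS t c : stop_prob t.+1 c =
  if halted c then 0 else avg (fun r => stop_prob t (step H c r)).
Proof.
rewrite /stop_prob (avg_tupleS _ (fun w => (stops_at c w)%:R)); case: ifPn => hc.
  rewrite /avg big1 ?mul0r // => r _; rewrite big1 ?mul0r // => w _.
  by rewrite /stops_at /= hc /= andbF.
congr avg; apply: boolp.funext => r; congr avg; apply: boolp.funext => w.
rewrite /stops_at /= hc /=; congr (_ && _)%:R.
by rewrite -add1n iotaDl all_map; apply: eq_all.
Qed.

Lemma stop_prob_ge0 t c : 0 <= stop_prob t c.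
Proof. by apply: avg_ge0 => w; rewrite ler0n. Qed.

Lemma avg_sum (T : finType) N (F : nat -> T -> R) :
  \sum_(t < N) avg (F t) = avg (fun x => \sum_(t < N) F t x).
Proof. by rewrite /avg -mulr_suml exchange_big. Qed.

Lemma sum_stop_prob N c : \sum_(t < N) stop_prob t c <= 1.
Proof.
elim: N c => [|N IH] c; first by rewrite big_ord0 ler01.
rewrite big_ord_recl stop_prob0 /=; case: (boolP (halted c)) => hc.
  by rewrite big1 ?addr0 // => t _; rewrite stop_probS hc.
rewrite add0r (eq_bigr (fun t : 'I_N => avg (fun r => stop_prob t (step H c r)))).
  by rewrite (avg_sum _ (fun t r => stop_prob t (step H c r))); apply: avg_le => // r; rewrite ler01.
by move=> t _; rewrite stop_probS (negPf hc).
Qed.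

(** The right side is the mean of the halting time cut off at [N]. After one step the factor [t + 1]
    splits into 1, whose terms sum to a probability, and [t], which is left to induction. *)
Lemma mean_stop_time N c : \sum_(t < N.+1) t%:R * stop_prob t c <= mean_time N c.
Proof.
elim: N c => [|N IH] c; first by rewrite big_ord1 mul0r.
rewrite big_ord_recl mul0r add0r [leRHS]/=; case: ifPn => hc.
  by rewrite big1 // => t _; rewrite stop_probS hc mulr0.
rewrite (eq_bigr (fun t : 'I_N.+1 => avg (fun r => stop_prob t (step H c r)) +
   avg (fun r => t%:R * stop_prob t (step H c r)))); last first.
  move=> t _; rewrite stop_probS (negPf hc) lift0 -natr1 mulrDl mul1r addrC.
  by congr (_ + _); rewrite /avg mulrA mulr_sumr.
rewrite big_split /=; apply: lerD.
  rewrite (avg_sum _ (fun t r => stop_prob t (step H c r))); apply: avg_le => [|r].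
    by rewrite ler01.
  exact: sum_stop_prob.
rewrite (avg_sum _ (fun t r => t%:R * stop_prob t (step H c r))).
by apply: ler_avg => r; apply: IH.
Qed.

End ExpectedTime.

Section OracleTime.
Import Order.TTheory GRing.Theory Num.Theory.
Variables (R : realType) (k n : nat) (A : algorithm k) (H : hypergraph n).
Local Open Scope ring_scope.

Lemma prob_timeE (m : memory n A) u t :
  prob_time R H m u t = stop_prob R H t (start m u).
Proof.
rewrite /prob_time /stop_prob /avg; congr (_ / _).
rewrite -sum1dep_card natr_sum big_mkcond /=; apply: eq_bigr => w _.
have -> : halts_at H m u w = stops_at H (start m u) w.
  rewrite /halts_at /stops_at; congr (_ && _); rewrite size_tuple.
  apply/forallP/allP => h i; last by apply: h; rewrite mem_iota ltn_ord.
  by rewrite mem_iota => /andP[_ it]; apply: (h (Ordinal it)).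
by case: ifP.
Qed.

(** Partial sums of the series lie below truncated means, so a bound uniform in the horizon survives
    the limit. *)
Lemma expected_time_le (m : memory n A) u (B : R) :
  (forall N, mean_time R H N (start m u) <= B) -> (expected_time R H m u <= B%:E)%E.
Proof.
move=> hB; rewrite /expected_time; apply: lime_le.
  apply: is_cvg_nneseries => t _ _; rewrite lee_fin mulr_ge0 ?ler0n //.
  by rewrite prob_timeE stop_prob_ge0.
apply: nearW => N; rewrite sumEFin lee_fin big_mkord.
apply: le_trans (hB N); apply: le_trans (mean_stop_time R H N _).
rewrite big_ord_recr /= (eq_bigr (fun t : 'I_N => t%:R * stop_prob R H t (start m u))).
  by rewrite lerDl mulr_ge0 ?ler0n ?stop_prob_ge0.
by move=> t _; rewrite prob_timeE.
Qed.

End OracleTime.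

Section Straightline.
Variables (k n s : nat) (H : hypergraph n) (m : s.-tuple bool).

Lemma exec_put_seq i e f q st T Q :
  exec (k := k) H m q (upd st i (eval_expr st m e) (eval_expr st m f)) T Q ->
  exec H m (Seq (Put i e f) q) st T.+2 Q.
Proof.
by move=> h; apply: (@exec_seq _ _ _ _ _ _ _ _ 1 T (eq _)); [exact: exec_put|move=> ? <-].
Qed.

Lemma exec_query_seq i e vs q st T Q :
  exec (k := k) H m q (upd st i (eval_expr st m e)
    (edge_query H [seq eval_expr st m v | v <- val vs])) T Q ->
  exec H m (Seq (Query i e vs) q) st T.+2 Q.
Proof.
by move=> h; apply: (@exec_seq _ _ _ _ _ _ _ _ 1 T (eq _)); [exact: exec_query|move=> ? <-].
Qed.

Definition query_args (l : seq expr) : k.-tuple expr :=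
  [tuple nth (Const 0) l i | i < k].

Lemma query_argsE l : size l = k -> val (query_args l) = l.
Proof.
move=> sl; apply: (@eq_from_nth _ (Const 0)); rewrite size_tuple // => i ik.
by rewrite -(tnth_nth _ _ (Ordinal ik)) tnth_mktuple.
Qed.

Definition conj_expr e f := Equal (Plus e f) (Const 2).
Definition disj_expr e f := Less (Const 0) (Plus e f).

Lemma eval_conj st e f (a b : bool) :
  eval_expr st m e = a -> eval_expr st m f = b -> eval_expr st m (conj_expr e f) = a && b.
Proof. by move=> /= -> ->; case: a; case: b. Qed.

End Straightline.

(* Arrays used by the oracle: 0 and 1 hold n (later the answer) and u; 2 the
   vertices drawn in a round; 3 the number of rounds, the success flag, the
   candidate answer and a query result; 4 the coloring tested by the search, as
   a binary counter; 5 the k-tuple being queried; 6 the carry position, the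
   flag "some edge is monochromatic" and a query result. *)
Definition size_expr := Get 0 (Const 0).
Definition vertex_expr := Get 1 (Const 0).

(** * One round of the sampling phase *)

Section Round.
Variables (k n s : nat) (H : hypergraph n) (m : s.-tuple bool).
Hypothesis k3 : 3 <= k.

Definition pos_exprs (S : {set 'I_(npos k)}) : seq expr :=
  [seq Get 2 (Const (val i)) | i <- enum S].

Lemma eval_pos_exprs (st : store) S :
  [seq eval_expr st m e | e <- pos_exprs S] = names (st 2) S.
Proof. by rewrite -map_comp. Qed.

Lemma size_pos_exprs S : size (pos_exprs S) = #|S|.
Proof. by rewrite size_map cardE. Qed.

Let ok := Get 3 (Const 1).
Let answer := Get 3 (Const 3).

Definition check_set (S : {set 'I_(npos k)}) : cmd k :=
  Seq (Query 3 (Const 3) (query_args k (pos_exprs S)))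
      (Put 3 (Const 1) (conj_expr ok answer)).

(** The crossing sets are unrolled into straight-line code whose length depends on [k] only. Cell 2
    of array 3 keeps the query joining [u] to [sideA'], which is the answer by [pass_sound]. *)
Definition check : cmd k :=
  Seq (Put 3 (Const 1) (Const 1))
  (Seq (seqs [seq check_set X | X <- enum (crossing k)])
  (Seq (Query 3 (Const 3) (query_args k (Const 0 :: pos_exprs (sideB k))))
  (Seq (Put 3 (Const 1) (conj_expr ok answer))
  (Seq (Query 3 (Const 2) (query_args k (vertex_expr :: pos_exprs (sideA' k))))
  (Seq (Query 3 (Const 3) (query_args k (vertex_expr :: pos_exprs (sideB k))))
       (Put 3 (Const 1)
          (conj_expr ok (disj_expr (Get 3 (Const 2)) answer)))))))).

Definition scratch_frame (st st' : store) : Prop :=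
  forall i b, (i != 3) || (b == 0) -> st' i b = st i b.

Lemma exec_check_sets (st : store) (b : bool) (l : seq {set 'I_(npos k)}) :
  {subset l <= crossing k} -> st 3 1 = b ->
  exec H m (seqs [seq check_set X | X <- l]) st (size l * 4).+1
    (fun st' => scratch_frame st st' /\
       st' 3 1 = b && all (fun S => edge_query H (names (st 2) S)) l).
Proof.
elim: l st b => [|S l IH] st b hl hb /=.
  by apply: exec_skip; split=> [i a _ |] //; rewrite andbT.
have cS : #|S| = k by have := hl S (mem_head _ _); rewrite inE => /andP[/eqP].
pose b' := b && edge_query H (names (st 2) S).
apply: exec_conseq (_ : exec _ _ _ _ (3 + (size l * 4).+1).+1 _) _ _; last 2 first.
- by rewrite mulSn; lia.
- by move=> st' h; exact: h.
apply: (@exec_seq _ _ _ _ _ _ _ _ 3 _ (fun st' => scratch_frame st st' /\ st' 3 1 = b')).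
  apply: exec_query_seq; apply: exec_put; split.
    by move=> i a; rewrite /upd; case: (i =P 3) => [->|_] //=; case: (a =P 0) => [->|_].
  rewrite query_argsE ?size_pos_exprs // eval_pos_exprs /upd /= hb /b'.
  by case: b {hb b'}; case: edge_query.
move=> st1 [fr h1]; apply: exec_conseq (IH st1 b' _ h1) _ _ => //.
  by move=> S' hS'; apply: hl; rewrite inE hS' orbT.
move=> st2 [fr2 ->]; split=> [i a h|]; first by rewrite fr2 // fr.
have -> : all (fun S => edge_query H (names (st1 2) S)) l =
          all (fun S => edge_query H (names (st 2) S)) l.
  by apply: eq_all => S'; congr edge_query; apply: eq_map => i; rewrite fr.
by rewrite /b' andbA.
Qed.

Definition check_time := #|crossing k| * 4 + 14.

Lemma exec_check (st : store) (u : nat) : st 1 0 = u ->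
  exec H m check st check_time
    (fun st' => [/\ scratch_frame st st', st' 3 1 = pass k H u (st 2)
       & st' 3 2 = edge_query H (u :: names (st 2) (sideA' k))]).
Proof.
move=> hu.
apply: (@exec_conseq _ _ _ _ _ _ _ ((#|crossing k| * 4).+1 + 9).+3); last 2 first.
- by rewrite /check_time; lia.
- by move=> st' h; exact: h.
apply: exec_put_seq => /=; set st0 := upd _ _ _ _.
have hl : {subset enum (crossing k) <= crossing k} by move=> S; rewrite mem_enum.
apply: exec_seq.
  by rewrite cardE; apply: (exec_check_sets (b := true) hl).
move=> st1 [fr h1].
have st02 : st0 2 = st 2 by [].
have e12 : forall S : {set 'I_(npos k)}, names (st1 2) S = names (st 2) S.
  by move=> S; rewrite /names; apply: eq_map => i; apply: fr.
have e1 : st1 1 0 = u by rewrite fr.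
rewrite st02 in h1.
have k1 : k.-1.+1 = k by lia.
have sB e : size (e :: pos_exprs (sideB k)) = k.
  by rewrite /= size_pos_exprs card_sideB.
have sA e : size (e :: pos_exprs (sideA' k)) = k.
  by rewrite /= size_pos_exprs card_sideA'.
do 1! [apply: exec_query_seq; apply: exec_put_seq].
do 2! apply: exec_query_seq.
apply: exec_put.
rewrite !query_argsE // !map_cons !eval_pos_exprs /= !/upd /=.
rewrite !e12 e1 h1; split.
- move=> i a hia; have e : st1 i a = st i a.
    by rewrite fr // /st0 /upd; move: hia; case: eqP => //= _ /eqP ->.
  by rewrite -e; move: hia; case: (i =P 3) => [->|] //= /eqP ->.
- rewrite /pass.
  have -> : all (fun S => edge_query H (names (st 2) S)) (enum (crossing k)) =
     [forall S in crossing k, edge_query H (names (st 2) S)].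
    apply/allP/forall_inP => h S; first by rewrite -mem_enum; exact: h.
    by rewrite mem_enum; exact: h.
  by case: [forall S in _, _]; do 3! case: edge_query.
- by [].
Qed.

End Round.

Section Draw.
Import Order.TTheory GRing.Theory Num.Theory.
Variables (k n s : nat) (H : hypergraph n) (m : s.-tuple bool).

Definition draw_positions : cmd k :=
  seqs [seq Sample 2 (Const i) | i <- iota 0 (npos k)].

Fixpoint put_names (st : store) (a : nat) (l : seq nat) : store :=
  if l is v :: l' then put_names (upd st 2 a v) a.+1 l' else st.

Lemma put_namesE (st : store) a l i b : put_names st a l i b =
  if (i == 2) && (a <= b < a + size l) then nth 0 l (b - a) else st i b.
Proof.
elim: l st a => [|v l IH] st a /=.
  by rewrite addn0; case: (leqP a b) => ab; rewrite ?andbF.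
rewrite IH /upd; case: (i =P 2) => //= _; case: (b =P a) => [->|ab].
  by rewrite ltnn leqnn subnn addnS ltnS leq_addr.
have -> : (a < b < a.+1 + size l) = (a <= b < a + (size l).+1) by lia.
case: ifP => // h.
by have -> : b - a = (b - a.+1).+1 by lia.
Qed.

Lemma returns_draw j a st K T b :
  (forall t : j.-tuple 'I_n,
     returns_within H T (Config K (put_names st a (map val t)) m) b) ->
  returns_within H (2 * j + T).+1
    (Config (seqs [seq Sample (k := k) 2 (Const i) | i <- iota a j] :: K) st m) b.
Proof.
elim: j a st => [|j IH] a st h /=.
  by apply: returns_step => r; have := h [tuple].
rewrite mulnS; apply: returns_seq; apply: returns_step => r /=.
apply: IH => t; exact: (h [tuple of r.2 :: t]).
Qed.

Lemma mean_time_draw (R : realType) N j a st K (B : seq nat -> R) : 0 < n ->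
  (forall l, 0 <= B l)%R ->
  (forall t : j.-tuple 'I_n,
     mean_time R H N (Config K (put_names st a (map val t)) m) <= B (map val t))%R ->
  (mean_time R H N
    (Config (seqs [seq Sample (k := k) 2 (Const i) | i <- iota a j] :: K) st m)
   <= (2 * j).+1%:R + avg (fun t : j.-tuple 'I_n => B (map val t)))%R.
Proof.
move=> n0; elim: j a st B => [|j IH] a st B B0 h /=.
  apply: (mean_time_step1 n0) => [|r]; first exact: avg_ge0.
  rewrite /avg card_tuple expn0 invr1 mulr1 (bigD1 [tuple]) //=.
  apply: le_trans (h [tuple]) _; rewrite lerDl sumr_ge0 //.
have -> : ((2 * j.+1).+1%:R = 1 + (1 + (2 * j).+1%:R) :> R)%R.
  have -> : (2 * j.+1).+1 = 1 + (1 + (2 * j).+1) by lia.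
  by rewrite 2!natrD.
rewrite -!addrA; apply: (mean_time_step1 n0) => [|r /=].
  by rewrite !addr_ge0 ?ler01 ?ler0n ?avg_ge0.
rewrite (avg_tupleS _ (fun l : seq 'I_n => B (map val l))).
have -> : ((2 * j).+1%:R + avg (fun x : 'I_n => avg (fun w : j.-tuple 'I_n => B (map val (x :: w))))
  = avg (fun x : 'I_n => (2 * j).+1%:R + avg (fun w : j.-tuple 'I_n => B (val x :: map val w))))%R.
  by rewrite avgD avg_const // card_ord.
apply: mean_time_sample => v /=.
  by rewrite addr_ge0 ?ler0n ?avg_ge0.
apply: (IH _ _ (fun l => B (val v :: l))) => // t.
exact: (h [tuple of v :: t]).
Qed.

End Draw.

(** * Exhaustive search for a legal coloring *)

Definition bit (t i : nat) : bool := odd (t %/ 2 ^ i).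

Lemma bit0 t : bit t 0 = odd t.
Proof. by rewrite /bit expn0 divn1. Qed.

Lemma bitS t i : bit t i.+1 = bit t./2 i.
Proof. by rewrite /bit expnS divnMA divn2. Qed.

Lemma bit_zero i : bit 0 i = false.
Proof. by rewrite /bit div0n. Qed.

(** The witness is the lowest zero bit, where the carry stops; [j <= t] bounds the time of an
    increment. *)
Lemma bit_succ t : exists2 j, j <= t &
  [/\ forall i, i < j -> bit t i, bit t j = false
    & forall i, bit t.+1 i = if i < j then false else (i == j) || bit t i].
Proof.
elim/ltn_ind: t => t IH; case: (boolP (odd t)) => ot; last first.
  exists 0 => //; split=> // [|[|i]]; first by rewrite bit0 (negPf ot).
    by rewrite bit0 /= ot.
  by rewrite !bitS /= uphalf_half (negPf ot) add0n.
have t0 : t./2 < t by case: t ot {IH} => // t _; rewrite ltn_half_double -addnn; lia.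
have [j jt [h1 h2 h3]] := IH _ t0.
exists j.+1; first lia; split=> [[|i] ij||[|i]].
- by rewrite bit0.
- by rewrite bitS h1.
- by rewrite bitS.
- by rewrite bit0 /= ot.
- by rewrite !bitS /= uphalf_half ot add1n h3 ltnS eqSS.
Qed.

Lemma bit_surj (n : nat) (c : nat -> bool) :
  exists2 t, t < 2 ^ n & forall i, i < n -> bit t i = c i.
Proof.
elim: n c => [|n IH] c; first by exists 0.
have [t ht hc] := IH (fun i => c i.+1).
exists (c 0 + t.*2); first by rewrite expnS; case: (c 0); lia.
case=> [|i] ni; first by rewrite bit0 oddD odd_double addbF; case: (c 0).
by rewrite bitS half_bit_double hc.
Qed.

Section Increment.
Variables (k n s : nat) (H : hypergraph n) (m : s.-tuple bool).

Let ptr := Get 6 (Const 0).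

Definition increment : cmd k :=
  Seq (Put 6 (Const 0) (Const 0))
  (Seq (While (Get 4 ptr) (Seq (Put 4 ptr (Const 0)) (Put 6 (Const 0) (Plus ptr (Const 1)))))
       (Put 4 ptr (Const 1))).

Lemma exec_increment (st : store) t : (forall i, st 4 i = bit t i) ->
  exec H m increment st (t * 4 + 6)
    (fun st' => (forall i, st' 4 i = bit t.+1 i) /\
       forall i b, i != 4 -> i != 6 -> st' i b = st i b).
Proof.
move=> hst; have [j jt [h1 h2 h3]] := bit_succ t.
(* [r] carries remain: the pointer is at [j - r], and the bits below it are already cleared. *)
pose I (r : nat) (st' : store) := r <= j /\ [/\ st' 6 0 = j - r,
   forall i, st' 4 i = if i < j - r then false else bit t i
   & forall i b, i != 4 -> i != 6 -> st' i b = st i b].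
apply: (@exec_conseq _ _ _ _ _ _ _ ((j * 4).+1 + 1).+3) (fun _ h => h); last lia.
apply: exec_put_seq; apply: (exec_seq (Q1 := I 0)).
  apply: (@exec_while _ _ _ _ _ _ _ 3 I j).
  - move=> r st' [rj [e6 e4 fr]]; split.
      by rewrite /= e6 e4 ltnn h1 //; lia.
    apply: exec_put_seq; apply: exec_put; split; first lia.
    rewrite /upd /= e6; split=> [|i|i b n4 n6].
    + by rewrite addn1; lia.
    + have -> : j - r = (j - r.+1).+1 by lia.
      rewrite e4 ltnS; case: (i =P j - r.+1) => [->|ne]; first by rewrite leqnn.
      by have -> : (i <= j - r.+1) = (i < j - r.+1) by lia.
    + by rewrite (negPf n4) (negPf n6) fr.
  - by move=> st' [_ [e6 e4 _]]; rewrite /= e6 e4 subn0 ltnn h2.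
  - split=> //; rewrite subnn; split=> [//|i|i b n4 n6]; first by rewrite ltn0 /upd /= hst.
    by rewrite /upd /= (negPf n6).
move=> st' [_ [e6 e4 fr]]; apply: exec_put; split=> [i|i b n4 n6]; last first.
  by rewrite /upd (negPf n4) /= fr.
rewrite /upd /= e6 e4 subn0 h3.
by case: (i =P j) => [->|ne] //=; rewrite ?ltnn.
Qed.

End Increment.

(** * Testing a coloring for legality by nested loops *)

Section LegalityTest.
Variables (k n s : nat) (H : hypergraph n) (m : s.-tuple bool).
Hypothesis k_gt0 : 0 < k.

Let idx b := Get 5 (Const b).
Let bad := Get 6 (Const 1).

(** Colors being 0 or 1, the sum is 0 or [k] exactly when the tuple is monochromatic. *)
Definition color_sum : expr :=
  foldr Plus (Const 0) [seq Get 4 (idx b) | b <- iota 0 k].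

Definition test_tuple : cmd k :=
  Seq (Query 6 (Const 2) (query_args k [seq idx b | b <- iota 0 k]))
      (Put 6 (Const 1) (disj_expr bad (conj_expr (Get 6 (Const 2))
         (disj_expr (Equal color_sum (Const 0)) (Equal color_sum (Const k)))))).

Fixpoint test_tuples (j : nat) : cmd k :=
  if j is j'.+1 then
    Seq (Put 5 (Const j') (Const 0))
        (While (Less (idx j') size_expr)
           (Seq (test_tuples j') (Put 5 (Const j') (Plus (idx j') (Const 1)))))
  else test_tuple.

Definition bad_tuple (x : nat -> nat) (V : nat -> nat) : bool :=
  edge_query H [seq V b | b <- iota 0 k] &&
  ((sumn [seq x (V b) | b <- iota 0 k] == 0) || (sumn [seq x (V b) | b <- iota 0 k] == k)).

Definition fset (V : nat -> nat) (j a : nat) : nat -> nat :=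
  fun b => if b == j then a else V b.

(** Entries of [V] from index [j] on are fixed by the outer loops, while the inner [j] entries range
    over all vertices. *)
Fixpoint bad_from (x : nat -> nat) (j : nat) (V : nat -> nat) : bool :=
  if j is j'.+1 then has (fun a => bad_from x j' (fset V j' a)) (iota 0 n)
  else bad_tuple x V.

Lemma bad_from_ext x j V V' :
  (forall b, j <= b -> V b = V' b) -> bad_from x j V = bad_from x j V'.
Proof.
elim: j V V' => [|j IH] V V' h /=.
  have e (f : nat -> nat) : [seq f (V b) | b <- iota 0 k] = [seq f (V' b) | b <- iota 0 k].
    by apply: eq_map => b; rewrite h.
  by rewrite /bad_tuple (e id) (e x).
apply: eq_has => a; apply: IH => b jb; rewrite /fset; case: eqP => // ne.
by rewrite h //; lia.
Qed.

Lemma bad_fromP x j V : reflect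
  (exists V', [/\ forall b, j <= b -> V' b = V b, forall b, b < j -> V' b < n & bad_tuple x V'])
  (bad_from x j V).
Proof.
apply: (iffP idP); elim: j V => [|j IH] V /=.
- by move=> h; exists V.
- move=> /hasP[a]; rewrite mem_iota add0n => /andP[_ an] /IH[V' [h1 h2 h3]].
  exists V'; split=> // b jb.
    by rewrite h1 ?(ltnW jb) // /fset gtn_eqF.
  case: (ltngtP b j) => bj; [exact: h2|lia|].
  by rewrite h1 bj // /fset eqxx.
- by move=> [V' [h1 _ h3]]; rewrite -[bad_tuple x V]/(bad_from x 0 V)
  (@bad_from_ext x 0 V V') // => b _; rewrite h1.
- move=> [V' [h1 h2 h3]]; apply/hasP; exists (V' j); first by rewrite mem_iota add0n h2.
  apply: IH; exists V'; split=> // b jb; last by apply: h2; lia.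
  by rewrite /fset; case: eqP => [->//|ne]; apply: h1; lia.
Qed.

Definition test_frame (j : nat) (st st' : store) : Prop :=
  forall i b, ((i != 5) || (j <= b)) && (i != 6) -> st' i b = st i b.

Fixpoint test_time (j : nat) : nat :=
  if j is j'.+1 then (n * (test_time j' + 3)).+3 else 3.

Lemma eval_color_sum (st : store) :
  eval_expr st m color_sum = sumn [seq st 4 (st 5 b) | b <- iota 0 k].
Proof. by rewrite /color_sum; elim: (iota 0 k) => //= b l ->. Qed.

Lemma exec_test_tuples (st : store) (b0 : bool) j : st 0 0 = n -> st 6 1 = b0 ->
  exec H m (test_tuples j) st (test_time j)
    (fun st' => test_frame j st st' /\ st' 6 1 = b0 || bad_from (st 4) j (st 5)).
Proof.
elim: j st b0 => [|j IH] st b0 hn hb /=.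
  apply: exec_query_seq; apply: exec_put; split.
    by move=> i b /andP[_ /negPf n6]; rewrite /upd n6.
  rewrite query_argsE ?size_map ?size_iota // -map_comp.
  have -> : [seq (eval_expr st m \o idx) b | b <- iota 0 k] = [seq st 5 b | b <- iota 0 k] by [].
  set st1 := upd st _ _ _; rewrite {1}/upd /= !eval_color_sum /=.
  have -> : [seq st1 4 (st1 5 b) | b <- iota 0 k] = [seq st 4 (st 5 b) | b <- iota 0 k] by [].
  rewrite /st1 /upd /= hb /bad_tuple.
  by case: b0 {hb}; case: edge_query; case: (sumn _ == 0); case: (sumn _ == k).
pose f a := bad_from (st 4) j (fset (st 5) j a).
(* [r] values of index [j] are still to be tried; the flag accounts for those below [n - r]. *)
pose I r (st' : store) := r <= n /\ [/\ st' 5 j = n - r, test_frame j.+1 st st' &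
   st' 6 1 = b0 || has f (iota 0 (n - r))].
apply: (@exec_conseq _ _ _ _ _ _ _ (n * (test_time j + 3)).+3 _ (I 0)) => //; last first.
  by move=> st' [_ [_ fr]]; rewrite subn0.
apply: exec_put_seq.
apply: (@exec_conseq _ _ _ _ _ _ _ (n * (test_time j + 1).+1.+1).+1 _ (I 0)) => //;
  last by rewrite ltnS leq_mul2l; apply/orP; right; lia.
apply: exec_while.
- move=> r st' [rn [e5 fr e6]].
  have e0 : st' 0 0 = n by rewrite fr.
  split; first by rewrite /= e5 e0; case: ltnP => //; lia.
  apply: exec_seq (IH st' _ e0 e6) _ => st2 [fr2 e62].
  have e25 : st2 5 j = n - r.+1 by rewrite fr2 ?leqnn ?orbT // e5.
  apply: exec_put; split; first lia; rewrite /upd /= eqxx e25; split.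
  + lia.
  + move=> i b hib; case: (i =P 5) hib => [->|n5] /= hib.
      move: hib; rewrite andbT => hib.
      by rewrite gtn_eqF //= fr2 /= ?(ltnW hib) // fr //= hib.
    by rewrite fr2 ?fr // (introF eqP n5).
  + rewrite e62 -orbA; congr (_ || _)%N.
    have -> : n - r = (n - r.+1) + 1 by lia.
    rewrite iotaD has_cat /= orbF add0n; congr (_ || _).
    have -> : st' 4 = st 4 by apply: boolp.funext => b; rewrite fr.
    apply: bad_from_ext => b jb; rewrite /fset; case: eqP => [->//|ne].
    by rewrite fr //= andbT; lia.
- move=> st' [_ [e5 fr _]]; have e0 : st' 0 0 = n by rewrite fr.
  by rewrite /= e5 e0 subn0 ltnn.
- split=> //; rewrite subnn /upd /= eqxx orbF; split=> // i b.
  by case: (i =P 5) => [->|] //= /andP[jb _]; rewrite gtn_eqF.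
Qed.

Definition bit_coloring (t : nat) : coloring n := [ffun v : 'I_n => bit t v].

(** A sum of [k] bits equal to 0 or [k] forces the bits to agree, so a bad tuple names a
    monochromatic edge. Conversely, by uniformity a monochromatic edge can be listed as a [k]-tuple,
    which the loops reach. *)
Lemma bad_from_legal t V : k_uniform k H ->
  bad_from (fun i => bit t i) k V = ~~ legal H (bit_coloring t).
Proof.
move=> /forall_inP hk; apply/bad_fromP/idP.
  move=> [V' [_ hn /andP[hq hs]]]; apply/negP => /edge_query_legal /(_ hq) hl.
  have [b hb] : exists b : bool, forall i, i < k -> bit t (V' i) = b.
    move: hs => {hl}.
    have sz : forall l, sumn [seq nat_of_bool (bit t (V' b)) | b <- l] <= size l.
      by elim=> //= a l IH; case: bit; lia.
    have allP' b l : (sumn [seq nat_of_bool (bit t (V' b)) | b <- l] == (if b then size l else 0))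
        -> {in l, forall i, bit t (V' i) = b}.
      elim: l => //= a l IH h i; have := sz l; rewrite inE => hl /orP[/eqP->|il].
        by move: h; case: b {IH}; case: bit => //=; lia.
      apply: IH => //; move: h; case: b; case: bit => //=; lia.
    case/orP => h; [exists false|exists true] => i ik.
      by apply: (allP' false _ h); rewrite mem_iota.
    by apply: (allP' true (iota 0 k)); rewrite ?size_iota // mem_iota.
  apply: (hl b) => v /mapP[i]; rewrite mem_iota => /andP[_ ik] e.
  by rewrite ffunE e hb.
case/forall_inPn => e eH /negPn /existsP[b /forall_inP hb].
have ce := eqP (hk e eH).
have se : size (map val (enum e)) = k by rewrite size_map -cardE.
pose W i := if i < k then nth 0 (map val (enum e)) i else V i.
have W1 : [seq W i | i <- iota 0 k] = map val (enum e).
  apply: (@eq_from_nth _ 0); rewrite ?size_map ?size_iota -?cardE // => i ik.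
  by rewrite (nth_map 0) ?size_iota // nth_iota // /W ik.
have Wv i : i < k -> exists2 v : 'I_n, v \in e & W i = v.
  move=> ik; have : W i \in map val (enum e) by rewrite /W ik mem_nth ?se.
  by move=> /mapP[v]; rewrite mem_enum; exists v.
exists W; split.
- by move=> i; rewrite /W ltnNge => ->.
- by move=> i /Wv[v _ ->].
- rewrite /bad_tuple W1; apply/andP; split.
    rewrite /edge_query; suff -> : [set v : 'I_n | val v \in map val (enum e)] = e by [].
    by apply/setP => v; rewrite inE mem_map ?mem_enum //; exact: val_inj.
  have -> : [seq nat_of_bool (bit t (W i)) | i <- iota 0 k] = nseq k (nat_of_bool b).
    apply: (@eq_from_nth _ 0); rewrite ?size_map ?size_iota ?size_nseq // => i ik.
    rewrite (nth_map 0) ?size_iota // nth_iota // nth_nseq ik.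
    by have [v ve ->] := Wv i ik; have := hb v ve; rewrite ffunE => /eqP ->.
  by rewrite sumn_nseq; case: b {hb}; rewrite ?mul1n ?mul0n eqxx ?orbT.
Qed.

End LegalityTest.

Definition first_legal n (H : hypergraph n) : nat :=
  find (fun t => legal H (bit_coloring n t)) (iota 0 (2 ^ n)).

Lemma first_legalP n (H : hypergraph n) : two_colorable H ->
  [/\ first_legal H < 2 ^ n, legal H (bit_coloring n (first_legal H))
    & forall t, t < first_legal H -> ~~ legal H (bit_coloring n t)].
Proof.
move=> /existsP[c hc]; pose P t := legal H (bit_coloring n t).
have hasP : has P (iota 0 (2 ^ n)).
  have [t tn ht] := bit_surj n (fun i => if insub i is Some v then c v else false).
  apply/hasP; exists t; first by rewrite mem_iota.
  rewrite /P; suff -> : bit_coloring n t = c by [].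
  by apply/ffunP => v; rewrite ffunE ht // valK.
have lt : first_legal H < 2 ^ n by move: hasP; rewrite has_find size_iota.
split=> // [|t tH].
  by have := nth_find 0 hasP; rewrite nth_iota.
have := @before_find _ 0 P _ _ tH; rewrite nth_iota ?add0n => [/negbT //|].
exact: ltn_trans lt.
Qed.

(** The first legal coloring in counter order, complemented if necessary so that vertex 0 has color
    0. It depends on [H] alone, hence calls agree without shared memory. *)
Definition canonical_color n (H : hypergraph n) (u : nat) : bool :=
  bit (first_legal H) u (+) bit (first_legal H) 0.

Lemma canonical_legal n (H : hypergraph n) : two_colorable H ->
  legal H [ffun v : 'I_n => canonical_color H v].
Proof.
move=> /first_legalP[_ /forall_inP hl _]; apply/forall_inP => e /hl.
apply: contra => /existsP[b /forall_inP hb]; apply/existsP.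
exists (b (+) bit (first_legal H) 0); apply/forall_inP => v /hb.
by rewrite !ffunE => /eqP <-; rewrite /canonical_color addbK.
Qed.

Section Search.
Variables (k n s : nat) (H : hypergraph n) (m : s.-tuple bool).
Hypothesis k_gt0 : 0 < k.

Definition test_legality : cmd k := Seq (Put 6 (Const 1) (Const 0)) (test_tuples k k).

Definition search : cmd k :=
  Seq test_legality (While (Get 6 (Const 1)) (Seq (increment k) test_legality)).

Definition search_frame (st st' : store) : Prop :=
  forall i b, i < 4 -> st' i b = st i b.

Lemma exec_test_legality (st : store) t : k_uniform k H ->
  st 0 0 = n -> (forall i, st 4 i = bit t i) ->
  exec H m test_legality st (test_time n k).+2
    (fun st' => [/\ search_frame st st', forall i, st' 4 i = bit t i
       & st' 6 1 = ~~ legal H (bit_coloring n t)]).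
Proof.
move=> hk hn ht; apply: exec_put_seq; apply: exec_conseq.
- by apply: (@exec_test_tuples _ _ _ _ _ k_gt0 _ false k); rewrite /upd.
- by [].
- move=> st' [fr ->]; rewrite -(bad_from_legal k_gt0 t (st 5)) //; split.
  + by move=> [|[|[|[|i]]]] b // _; rewrite fr.
  + by move=> i; rewrite fr // /upd /= ht.
  + rewrite /= /upd /=; congr (nat_of_bool (bad_from _ _ _ _ _)).
    by apply: boolp.funext => i; rewrite ht.
Qed.

Definition search_time :=
  ((test_time n k).+2 + (2 ^ n * ((2 ^ n * 4 + 6) + (test_time n k).+2).+2).+1).+1.

Lemma exec_search (st : store) : k_uniform k H -> two_colorable H ->
  st 0 0 = n -> (forall i, st 4 i = 0) ->
  exec H m search st search_time
    (fun st' => search_frame st st' /\ forall i, st' 4 i = bit (first_legal H) i).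
Proof.
move=> hk hc hn h4; have [t0n leg0 legN] := first_legalP hc.
set t0 := first_legal H in t0n leg0 legN *.
(* [r] is the distance from the current counter to the first legal one. *)
pose I r (st' : store) := r <= t0 /\ [/\ search_frame st st', forall i, st' 4 i = bit (t0 - r) i
  & st' 6 1 = ~~ legal H (bit_coloring n (t0 - r))].
apply: (@exec_conseq _ _ _ _ _ _ _ ((test_time n k).+2 +
  (t0 * ((2 ^ n * 4 + 6) + (test_time n k).+2).+2).+1).+1 _ (I 0)).
- apply: (@exec_seq _ _ _ _ _ _ _ _ _ _ (I t0)).
    apply: exec_conseq (exec_test_legality (t := 0) hk hn _) _ _ => // [i|st' [h1 h2 h3]].
      by rewrite h4 bit_zero.
    by split=> //; rewrite subnn.
  move=> st1 hI; apply: (@exec_while _ _ _ _ _ _ _ _ I) hI.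
    move=> r st2 [rt [fr e4 e6]]; split.
      by rewrite /= e6 legN //; lia.
    apply: exec_seq.
      apply: exec_conseq (exec_increment k H m e4) _ (fun _ h => h).
      by rewrite leq_add2r leq_mul2r /=; lia.
    move=> st3 [e43 fr3].
    have e : (t0 - r.+1).+1 = t0 - r by lia.
    apply: exec_conseq (exec_test_legality (t := t0 - r) hk _ _) _ _ => //.
    - by rewrite fr3 // fr.
    - by move=> i; rewrite e43 e.
    - move=> st4 [fr4 e44 e46]; split; first lia; split=> // i b ib.
      rewrite fr4 // fr3 ?fr //; lia.
  by move=> st2 [_ [_ _ e6]]; rewrite /= e6 subn0 leg0.
- by rewrite /search_time !ltnS leq_add2l ltnS leq_mul2r (ltnW t0n) orbT.
- by move=> st' [_ [h1 h2 _]]; split=> // i; rewrite h2 subn0.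
Qed.

End Search.

Lemma names_ext k (p p' : nat -> nat) (S : {set 'I_(npos k)}) :
  (forall i, i < npos k -> p i = p' i) -> names p S = names p' S.
Proof. by move=> h; rewrite /names; apply: eq_map => i; apply: h; apply: ltn_ord. Qed.

Lemma pass_ext k n (H : hypergraph n) u (p p' : nat -> nat) :
  (forall i, i < npos k -> p i = p' i) -> pass k H u p = pass k H u p'.
Proof.
move=> h; rewrite /pass !(names_ext _ h); congr (_ && _).
by apply: eq_forallb => S; rewrite (names_ext _ h).
Qed.

(** * The oracle: sampling rounds followed by the search *)

Section Oracle.
Variable k C : nat.

Let ok := Get 3 (Const 1).

(** The nested [Equal] is the exclusive or of the colors of [u] and vertex 0, which is the
    normalization at vertex 0. *)
Definition fallback : cmd k :=
  Seq (search k)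
    (Put 0 (Const 0) (Equal (Equal (Get 4 vertex_expr) (Get 4 (Const 0))) (Const 0))).

Definition finish : cmd k :=
  Cond ok (Put 0 (Const 0) (Get 3 (Const 2))) fallback.

Definition round : cmd k :=
  Seq (Put 3 (Const 0) (Plus (Get 3 (Const 0)) (Const 1)))
      (Seq (draw_positions k) (check k)).

(** Multiplication by the program constant [C], unfolded into additions. *)
Definition times_expr (e : expr) : expr := iter C (Plus e) (Const 0).

Definition guard : expr :=
  conj_expr (Less (Get 3 (Const 0)) (times_expr size_expr)) (Equal ok (Const 0)).

Definition oracle : cmd k := Seq (While guard round) finish.

Variables (n s : nat) (H : hypergraph n) (m : s.-tuple bool) (u : 'I_n).
Hypothesis k3 : 3 <= k.
Hypothesis H_uniform : k_uniform k H.
Hypothesis H_colorable : two_colorable H.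

Let loop (st : store) : config k s := Config [:: While guard round; finish] st m.

(** All rounds so far have failed, [j] of the [C * n] rounds remain, and the search counter is still
    zero. *)
Definition ready (j : nat) (st : store) : Prop :=
  [/\ st 0 0 = n, st 1 0 = u, forall i, st 4 i = 0, st 3 1 = 0 & st 3 0 + j = C * n].

Definition answered (st : store) : Prop := st 3 1 = 1 /\ st 3 2 = canonical_color H u.

Lemma eval_times (st : store) : eval_expr st m (times_expr size_expr) = C * st 0 0.
Proof. by rewrite /times_expr; elim: C => //= c ->; rewrite mulSn. Qed.

Lemma guard_ready j st : ready j st -> (eval_expr st m guard != 0) = (j != 0).
Proof.
move=> [h0 _ _ h1 h3].
have e1 : eval_expr st m (Less (Get 3 (Const 0)) (times_expr size_expr)) = (j != 0).
  rewrite /= eval_times h0 -h3; case: j {h3} => [|j]; first by rewrite addn0 ltnn.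
  by rewrite addnS ltnS leq_addr.
have e2 : eval_expr st m (Equal ok (Const 0)) = true by rewrite /= h1.
by rewrite (eval_conj e1 e2) andbT; case: (j != 0).
Qed.

Lemma guard_answered st : answered st -> eval_expr st m guard = 0.
Proof.
move=> [h1 _]; rewrite (@eval_conj _ m st _ _ (st 3 0 < C * st 0 0) false) ?andbF //=.
  by rewrite eval_times.
by rewrite h1.
Qed.

Lemma returns_answered st : answered st -> returns_within H 4 (loop st) (canonical_color H u).
Proof.
move=> ha; apply: returns_while; rewrite guard_answered //=.
have [h1 h2] := ha; do 2! apply: returns_step => ? /=.
by rewrite h1 /=; apply: returns_halted; rewrite /upd /=.
Qed.

Definition finish_time := (search_time k n).+4.

Lemma returns_exhausted st : ready 0 st ->
  returns_within H finish_time (loop st) (canonical_color H u).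
Proof.
move=> hr; apply: returns_while; rewrite (guard_ready hr) /=.
case: hr => h0 h1 h4 hok _; apply: returns_step => ? /=; rewrite hok /=.
apply: returns_seq; rewrite -addn1; apply: returns_exec.
  by apply: exec_search => //; lia.
move=> st' [fr e4]; apply: returns_step => ? /=; apply: returns_halted.
rewrite /upd /= !e4 fr // h1 /canonical_color.
by do 2! case: bit.
Qed.

Definition round_time := 2 * npos k + check_time k + 5.

Lemma exec_check_round j (st : store) (t : (npos k).-tuple 'I_n) :
  ready j st ->
  exec H m (check k) (put_names st 0 (map val t)) (check_time k)
    (fun st' => if pass k H u (nth 0 (map val t)) then answered st' else ready j st').
Proof.
move=> [h0 h1 h4 hok h3]; set st1 := put_names _ _ _.
have e1 i b : i != 2 -> st1 i b = st i b.
  by move=> /negPf i2; rewrite /st1 put_namesE i2.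
have e2 i : i < npos k -> st1 2 i = nth 0 (map val t) i.
  by move=> ik; rewrite /st1 put_namesE /= size_map size_tuple add0n ik subn0.
apply: exec_conseq (@exec_check k n s H m k3 st1 u _) _ _ => //; first by rewrite e1.
move=> st' [fr hp ha]; rewrite -(pass_ext H u e2).
case: ifPn => pass_t; last first.
  by split; [rewrite fr // e1|rewrite fr // e1|move=> i; rewrite fr // e1
    |rewrite hp (negPf pass_t)|rewrite fr // e1].
split; first by rewrite hp pass_t.
have n0 : 0 < n by apply: leq_ltn_trans (ltn_ord u).
(* A successful round agrees with every legal coloring, in particular with the one that the search
   would find. *)
have [_ leg _] := first_legalP H_colorable.
rewrite ha; congr nat_of_bool.
rewrite -(@pass_sound k n H _ (Ordinal n0) u (st1 2) _ _ _ leg) //; last 2 first.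
- lia.
- move=> i ik; rewrite e2 //.
  have /mapP[v _ ->] : nth 0 (map val t) i \in map val t by rewrite mem_nth ?size_map ?size_tuple.
  exact: ltn_ord.
by rewrite !ffunE.
Qed.

Lemma returns_ready j st : ready j st ->
  returns_within H (j * round_time + (finish_time + 4)) (loop st) (canonical_color H u).
Proof.
elim: j st => [|j IH] st hr.
  by apply: (@returns_mono _ _ _ _ finish_time _); [lia|exact: returns_exhausted].
apply: (@returns_mono _ _ _ _
  ((2 * npos k + (check_time k + (j * round_time + (finish_time + 4)))).+1.+4)).
  by rewrite /round_time mulSn; lia.
apply: returns_while; rewrite (guard_ready hr) /=.
apply: returns_seq; apply: returns_step => ? /=; apply: returns_seq.
rewrite /draw_positions; apply: returns_draw => t; apply: returns_exec.
  apply: (@exec_check_round j); case: hr => h0 h1 h4 hok h3; split=> //.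
  by rewrite /upd /=; lia.
move=> st' /=; case: ifP => _ hst'; last exact: IH.
by apply: returns_mono (returns_answered hst'); lia.
Qed.

Section MeanTime.
Import Order.TTheory GRing.Theory Num.Theory.
Variables (R : realType) (Q : nat).
Hypothesis Q_gt0 : 0 < Q.
Hypothesis H_dense : n ^ npos k <= Q * #|passing k H u|.
Local Open Scope ring_scope.

Let fail : R := 1 - Q%:R^-1.

Lemma fail_ge0 : 0 <= fail.
Proof. by rewrite subr_ge0 invf_le1 ?ltr0n // ler1n. Qed.

Lemma avg_pass (a X : R) : 0 <= a -> 0 <= X ->
  avg (fun t : (npos k).-tuple 'I_n => if pass k H u (nth 0%N (map val t)) then a else X)
  <= a + fail * X.
Proof.
move=> a0 X0; have n0 : (0 < n)%N by apply: leq_ltn_trans (ltn_ord u).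
pose P := passing k H u.
have -> : avg (fun t : (npos k).-tuple 'I_n =>
     if pass k H u (nth 0%N (map val t)) then a else X)
   = (#|P|%:R * a + #|~: P|%:R * X) / #|{: (npos k).-tuple 'I_n}|%:R.
  congr (_ / _); rewrite (bigID (mem P)) /=; congr (_ + _).
    rewrite (eq_bigr (fun=> a)); last by move=> t; rewrite inE => ->.
    by rewrite sumr_const mulr_natl.
  rewrite (eq_bigr (fun=> X)); last by move=> t; rewrite inE => /negPf ->.
  rewrite (eq_bigl (fun t => t \in ~: P)); last by move=> t; rewrite in_setC.
  by rewrite sumr_const mulr_natl.
rewrite card_tuple card_ord.
have nk : (0 < n ^ npos k)%N by rewrite expn_gt0 n0.
have cC : #|P|%:R + #|~: P|%:R = (n ^ npos k)%:R :> R.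
  by rewrite -natrD cardsC card_tuple card_ord.
have hP : (n ^ npos k)%:R <= Q%:R * #|P|%:R :> R by rewrite -natrM ler_nat.
rewrite ler_pdivrMr ?ltr0n //.
have P0 : 0 <= #|P|%:R :> R by rewrite ler0n.
have C0 : 0 <= #|~: P|%:R :> R by rewrite ler0n.
have Q0 : 0 < Q%:R :> R by rewrite ltr0n.
have hP' : Q%:R^-1 * (n ^ npos k)%:R <= #|P|%:R :> R by rewrite ler_pdivrMl.
rewrite mulrDl lerD //.
  by rewrite mulrC ler_wpM2l // -cC lerDl.
rewrite mulrAC ler_wpM2r // /fail mulrBl mul1r -{1}cC.
by rewrite lerBrDr addrC lerD2r.
Qed.

(** With [c = round_time + 4], covering a round and a successful exit, the recursion
    [T_(j+1) <= c + (1 - 1/Q) T_j] has fixed point [c * Q]; the cost of the fallback on top of it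
    shrinks by the factor [fail] in each round. *)
Lemma mean_time_ready N j st : ready j st ->
  mean_time R H N (loop st) <= (round_time + 4)%:R * Q%:R + fail ^+ j * finish_time%:R.
Proof.
have n0 : (0 < n)%N by apply: leq_ltn_trans (ltn_ord u).
elim: j st => [|j IH] st hr.
  apply: le_trans (mean_time_returns R N (returns_exhausted hr)) _.
  by rewrite expr0 mul1r lerDr mulr_ge0 ?ler0n.
set X := _ + _ in IH.
have X0 : 0 <= X by rewrite addr_ge0 ?mulr_ge0 ?exprn_ge0 ?fail_ge0 ?ler0n.
have f0 := fail_ge0.
have -> : (round_time + 4)%:R * Q%:R + fail ^+ j.+1 * finish_time%:R
    = (round_time + 4)%:R + fail * X :> R.
  rewrite /X (mulrDr fail) exprS -(mulrA fail) addrA; congr (_ + _).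
  rewrite /fail mulrBl mul1r mulrCA mulVf ?mulr1 ?pnatr_eq0 -?lt0n //.
  by rewrite addrC subrK.
pose B (l : seq nat) : R :=
  (check_time k)%:R + (if pass k H u (nth 0%N l) then 4 else X).
have B0 l : 0 <= B l by rewrite /B addr_ge0 ?ler0n //; case: ifP.
have avgB : avg (fun t : (npos k).-tuple 'I_n => B (map val t))
    <= (check_time k)%:R + (4 + fail * X).
  rewrite /B avgD avg_const ?card_tuple ?card_ord ?expn_gt0 ?n0 // lerD2l.
  by apply: avg_pass.
have -> : (round_time + 4)%:R + fail * X =
    1 + (1 + (1 + (1 + ((2 * npos k).+1%:R + ((check_time k)%:R + (4 + fail * X)))))).
  have -> : (round_time + 4 =
      1 + (1 + (1 + (1 + ((2 * npos k).+1 + (check_time k + 4))))))%N.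
    by rewrite /round_time; lia.
  by rewrite 6!natrD !addrA.
have p0 : 0 <= (check_time k)%:R + (4 + fail * X).
  by rewrite !addr_ge0 ?ler0n ?mulr_ge0.
have p1 : 0 <= (2 * npos k).+1%:R + ((check_time k)%:R + (4 + fail * X)).
  by rewrite addr_ge0 ?ler0n.
apply: (mean_time_step1 n0) => [|? /=]; first by rewrite !addr_ge0 ?ler01 ?ler0n ?mulr_ge0.
rewrite (guard_ready hr) /=.
apply: (mean_time_step1 n0) => [|? /=]; first by rewrite !addr_ge0 ?ler01 ?ler0n ?mulr_ge0.
apply: (mean_time_step1 n0) => [|? /=]; first by rewrite !addr_ge0 ?ler01 ?ler0n ?mulr_ge0.
apply: (mean_time_step1 n0) => [|? /=]; first by [].
set st1 := upd _ _ _ _.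
have hr1 : ready j st1.
  by case: hr => h0 h1 h4 hok h3; split=> //; rewrite /st1 /upd /=; lia.
apply: le_trans (_ : _ <= (2 * npos k).+1%:R +
   avg (fun t : (npos k).-tuple 'I_n => B (map val t))) _; last by rewrite lerD2l.
rewrite /draw_positions; apply: mean_time_draw => // t.
apply: mean_time_exec (exec_check_round t hr1) _ _ => [|st' /=].
  by case: ifP.
case: ifP => _ hst'; last exact: IH.
exact: mean_time_returns (returns_answered hst').
Qed.

End MeanTime.

End Oracle.

(** * Exponential bounds on the worst-case running time *)

Definition exp_bounded (f : nat -> nat) : Prop :=
  exists e, forall n, 0 < n -> f n <= 2 ^ (e * n).

Lemma exp_bounded_const a : exp_bounded (fun=> a).
Proof.
exists a => n n0; apply: leq_trans (ltnW (ltn_expl a (ltnSn 1))) _.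
by rewrite leq_exp2l // leq_pmulr.
Qed.

Lemma exp_bounded_id : exp_bounded (fun n => n).
Proof. by exists 1 => n _; rewrite mul1n ltnW // ltn_expl. Qed.

Lemma exp_bounded_exp : exp_bounded (fun n => 2 ^ n).
Proof. by exists 1 => n _; rewrite mul1n. Qed.

Lemma exp_bounded_mul f g :
  exp_bounded f -> exp_bounded g -> exp_bounded (fun n => f n * g n).
Proof.
move=> [a ha] [b hb]; exists (a + b) => n n0.
by rewrite mulnDl expnD leq_mul ?ha ?hb.
Qed.

Lemma exp_bounded_add f g :
  exp_bounded f -> exp_bounded g -> exp_bounded (fun n => f n + g n).
Proof.
move=> [a ha] [b hb]; exists (1 + (a + b)) => n n0.
have := ha n n0; have := hb n n0; rewrite !mulnDl mul1n !expnD.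
have := expn_gt0 2 (a * n); have := expn_gt0 2 (b * n).
have : 2 ^ 1 <= 2 ^ n by rewrite leq_exp2l.
rewrite expn1; move: (2 ^ n) (2 ^ (a * n)) (2 ^ (b * n)) => x y z /= x2 z0 y0 hf hg.
have h1 := leq_pmulr y z0; have h2 := leq_pmull z y0.
by have h3 := leq_mul x2 (leqnn (y * z)); lia.
Qed.

Lemma exp_bounded_S f : exp_bounded f -> exp_bounded (fun n => (f n).+1).
Proof.
move=> hf; have [e he] := exp_bounded_add hf (exp_bounded_const 1).
by exists e => n n0; rewrite -addn1 he.
Qed.

Lemma exp_bounded_test_time j : exp_bounded (fun n => test_time n j).
Proof.
elim: j => [|j IH] /=; first exact: exp_bounded_const.
do 3! apply: exp_bounded_S; apply: exp_bounded_mul exp_bounded_id _.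
exact: exp_bounded_add IH (exp_bounded_const 3).
Qed.

Lemma exp_bounded_finish_time k : exp_bounded (finish_time k).
Proof.
do 5! apply: exp_bounded_S; apply: exp_bounded_add.
  by do 2! apply: exp_bounded_S; apply: exp_bounded_test_time.
apply: exp_bounded_S; apply: exp_bounded_mul exp_bounded_exp _.
do 2! apply: exp_bounded_S; apply: exp_bounded_add; last first.
  by do 2! apply: exp_bounded_S; apply: exp_bounded_test_time.
apply: exp_bounded_add (exp_bounded_const 6).
exact: exp_bounded_mul exp_bounded_exp (exp_bounded_const 4).
Qed.

Definition oracle_time k C n := (C * n * round_time k + (finish_time k n + 4)).+1.

Lemma exp_bounded_oracle_time k C : exp_bounded (oracle_time k C).
Proof.
apply: exp_bounded_S; apply: exp_bounded_add.
  apply: exp_bounded_mul (exp_bounded_const _).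
  exact: exp_bounded_mul (exp_bounded_const C) exp_bounded_id.
exact: exp_bounded_add (exp_bounded_finish_time k) (exp_bounded_const 4).
Qed.

Definition oracle_algorithm k C : algorithm k := Algorithm (oracle k C) (fun=> 0).

(** * Correctness of the oracle *)

Section Correctness.
Variables (k C n : nat) (H : hypergraph n).
Hypothesis k3 : 3 <= k.
Hypothesis hH : H \in two_colorable_kgraphs k n.
Let A := oracle_algorithm k C.

Lemma ready_init (u : 'I_n) : ready C u (C * n)
  (upd (upd (fun _ _ => 0) 0 0 n) 1 0 (val u)).
Proof. by []. Qed.

Lemma returns_start (m : memory n A) u :
  returns_within H (oracle_time k C n) (start m u) (canonical_color H u).
Proof.
move: hH; rewrite inE => /andP[hk hc]; apply: returns_seq.
exact: returns_ready (ready_init u).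
Qed.

Lemma call_canonical (m m' : memory n A) u a :
  call H m u a m' -> a = canonical_color H u.
Proof.
move=> [w [[hh ha] _]].
(* Padding by arbitrary draws reaches the worst-case time bound and leaves a halted run
   unchanged. *)
pose w' : seq (draw n) := w ++ nseq (oracle_time k C n) (false, u).
have sw : oracle_time k C n <= size w' by rewrite size_cat size_nseq leq_addl.
have [_] := returns_start m u sw; rewrite run_cat run_halted // ha.
by case: a {ha}; case: canonical_color.
Qed.

Lemma oracle_always_returns : always_returns A H.
Proof.
move=> m u w _; exists (oracle_time k C n), (canonical_color H u).
by apply: returns_start; rewrite size_mkseq.
Qed.

Lemma oracle_consistent : consistent A H.
Proof.
move=> u a m _ hm; exists [ffun v : 'I_n => canonical_color H v].
  by apply: canonical_legal; move: hH; rewrite inE => /andP[].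
by move=> i; rewrite ffunE (call_canonical (hm i)).
Qed.

End Correctness.

(** * Running time on typical and on exceptional hypergraphs *)

Section AverageTime.
Import Order.TTheory GRing.Theory Num.Theory.
Local Open Scope ring_scope.

Lemma fail_exp_le (R : realType) (Q j F : nat) : (1 < Q)%N -> (F <= 2 ^ j)%N ->
  (1 - Q%:R^-1) ^+ (Q * j) * F%:R <= 1 :> R.
Proof.
move=> Q1 hF; have Q0 : 0 < Q%:R :> R by rewrite ltr0n; lia.
have -> : 1 - Q%:R^-1 = Q.-1%:R / Q%:R :> R.
  have e : Q%:R = Q.-1%:R + 1 :> R by rewrite natr1 prednK // ltnW.
  by apply: (mulIf (lt0r_neq0 Q0)); rewrite mulrBl mul1r mulVf ?divfK ?gt_eqF // e addrK.
rewrite expr_div_n mulrAC ler_pdivrMr ?exprn_gt0 // mul1r -!natrX -natrM ler_nat.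
have := double_pred_exp_iter Q1 (leqnn (Q * j)); apply: leq_trans.
by rewrite mulnC leq_mul2r hF orbT.
Qed.

Lemma little_o_zero (R : realType) :
  ((fun _ : nat => 0%:R : R^o) =o_\oo (fun n : nat => n%:R : R^o))%classic.
Proof.
apply/eqoP => e e0; near=> n; rewrite normr0 mulr_ge0 ?(ltW e0) //.
Unshelve. all: by end_near.
Qed.

Variables (R : realType) (k C : nat).
Hypothesis k3 : (3 <= k)%N.
Let Q := density_const k.
Let A := oracle_algorithm k C.

Lemma density_const_gt1 : (1 < Q)%N.
Proof.
rewrite /Q /density_const.
have h1 := expn_gt0 2 (#|crossing k| + 2).+1.
have h2 : (0 < (2 * (2 * (2 * k) ^ k) * npos k ^ 2) ^ npos k)%N.
  rewrite !(expn_gt0, muln_gt0) /=; rewrite /npos; lia.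
move: h1 h2; move: (2 ^ _)%N (_ ^ npos k)%N; nia.
Qed.

Lemma graph_time_le n (H : hypergraph n) (B : R) : 0 <= B ->
  (forall (m : memory n A) u N, mean_time R H N (start m u) <= B) ->
  (graph_time R A H <= B%:E)%E.
Proof.
move=> B0 hB; rewrite /graph_time; apply: bigmax_le; first by rewrite lee_fin.
move=> u _; apply: ge_ereal_sup => _ [m _ <-].
exact: expected_time_le.
Qed.

Lemma graph_time_worst n (H : hypergraph n) : H \in two_colorable_kgraphs k n ->
  (graph_time R A H <= (oracle_time k C n)%:R%:E)%E.
Proof.
move=> hH; apply: graph_time_le => // m u N.
exact: (mean_time_returns R N (returns_start k3 hH m u)).
Qed.

Lemma graph_time_typical n (H : hypergraph n) e : H \in two_colorable_kgraphs k n ->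
  typical k Q H -> C = (Q * e)%N -> ((0 < n)%N -> (finish_time k n <= 2 ^ (e * n))%N) ->
  (graph_time R A H <= ((round_time k + 4) * Q + 2)%:R%:E)%E.
Proof.
rewrite inE => /andP[hk hc] /forallP ht eC hf; apply: graph_time_le => [|m u N].
  by rewrite ler0n.
have n0 : (0 < n)%N by apply: leq_ltn_trans (ltn_ord u).
have Q1 := density_const_gt1.
have h := fail_exp_le R Q1 (hf n0).
(* The summand 2 is one step for the outer [Seq] and at most one for the expected cost of the
   fallback. *)
rewrite natrD (natrD _ 1 1) addrCA.
apply: (mean_time_step1 n0) => [|r]; first by rewrite addr_ge0 ?ler0n ?ler01.
apply: le_trans (mean_time_ready m k3 hk hc R (ltnW Q1) (ht u) N (ready_init C u)) _.
by rewrite natrM lerD2l eC -mulnA.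
Qed.

End AverageTime.

Section Main.
Import Order.TTheory GRing.Theory Num.Theory.
Local Open Scope ring_scope.

(** Graphs outside [B] contribute at most [a] to the average; those in [B] may cost [b] each but are
    few enough to contribute at most [c]. *)
Lemma average_time_le (R : realType) k (A : algorithm k) n (a b c : nat) (B : {set hypergraph n}) :
  (forall H, H \in two_colorable_kgraphs k n -> (graph_time R A H <= b%:R%:E)%E) ->
  (forall H, H \in two_colorable_kgraphs k n -> H \notin B -> (graph_time R A H <= a%:R%:E)%E) ->
  (#|B| * b <= c * #|two_colorable_kgraphs k n|)%N ->
  (average_time R A n <= (a + c)%:R%:E)%E.
Proof.
move=> hb ha hB; rewrite /average_time; set T := two_colorable_kgraphs k n.
have h1 : (\sum_(H in T) graph_time R A H <= ((a + c) * #|T|)%:R%:E)%E.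
  apply: (@le_trans _ _ (\sum_(H in T) (a + (H \in B) * b)%:R%:E)%E).
    apply: lee_sum => H HT; case: (boolP (H \in B)) => HB.
      by apply: le_trans (hb H HT) _; rewrite lee_fin ler_nat mul1n leq_addl.
    by apply: le_trans (ha H HT HB) _; rewrite lee_fin ler_nat leq_addr.
  rewrite sumEFin lee_fin -natr_sum ler_nat big_split sum_nat_const /= mulnDl mulnC leq_add2l.
  apply: leq_trans hB; rewrite -big_distrl leq_mul2r; apply/orP; right.
  rewrite -sum1_card big_mkcond [leqRHS]big_mkcond /=; apply: leq_sum => H _.
  by case: ifP; case: (H \in B).
apply: le_trans (lee_wpmul2l _ h1) _; first by rewrite lee_fin invr_ge0 ler0n.
rewrite -EFinM lee_fin natrM mulrCA; have [T0|T0] := posnP #|T|.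
  by rewrite T0 invr0 mul0r mulr0.
by rewrite mulVf ?mulr1 // pnatr_eq0 -lt0n.
Qed.

End Main.

Theorem theorem1p4 (R : realType) (k : nat) (hk : (3 <= k)%N) :
  exists A : algorithm k,
    [/\ coloring_oracle R A,
        exists C : R, forall n : nat, (average_time R A n <= C%:E)%E
      & memoryless A].
Proof.
have [e he] := exp_bounded_finish_time k.
(* After [Q * e * n] rounds on a typical graph the failure probability is at most [2 ^ -(e * n)],
   which offsets the fallback time. Only then is [E] fixed, from the worst-case time for this [C],
   and atypical graphs are rare enough for any [E]. *)
pose Q := density_const k; pose C := Q * e.
have [E hE] := exp_bounded_oracle_time k C.
have [c hc] := atypical_rare hk E.
exists (oracle_algorithm k C); split=> //.
  split=> [n H hH|n H hH|]; last exact: little_o_zero.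
    exact: oracle_always_returns.
  exact: oracle_consistent.
pose a := (round_time k + 4) * Q + 2.
exists (a + c)%:R%R => n.
apply: (@average_time_le R k _ n a (oracle_time k C n) c (atypical k n)) => [H hH|H hH|].
- exact: graph_time_worst.
- rewrite inE hH /= negbK => ht; apply: (graph_time_typical _ hk hH ht) => //.
  exact: he.
(* The exponential bound needs [0 < n]; for [n = 0] every graph is vacuously typical. *)
- have [n0|n0] := posnP n.
    suff -> : atypical k n = set0 by rewrite cards0.
    apply/setP => H; rewrite !inE; apply/negbTE; rewrite negb_and negbK; apply/orP; right.
    by apply/forallP => u; have := ltn_ord u; rewrite {2}n0.
  by apply: leq_trans (hc n); rewrite leq_mul2l hE ?orbT.
Qed.
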